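(* Let $(X_t)_{t\ge0}$ be a process on $\mathbb{R}$ with $$\limsup_{t\to\infty}X_t=\infty\quad\text{and}\quad\liminf_{t\to\infty}X_t=-\infty\quad\text{a.s.},$$ and let $b\in\mathbb{R}$ be such that, with $\tau^b:=\inf\{t\ge0\mid X_t\le b\}$ and $\sigma^b:=\inf\{t\ge0\mid X_t\ge b\}$, $$\mathbb{P}_x(X_{\tau^b}=b)=0\ \text{ for all }x>b,\qquad \mathbb{P}_x(X_{\sigma^b}=b)=0\ \text{ for all }x<b.$$ Set $\sigma_0:=0$ and, for $n\ge1$, $\tau_n:=\inf\{t\ge\sigma_{n-1}\mid X_t<b\}$ and $\sigma_n:=\inf\{t\ge\tau_n\mid X_t>b\}$. For the process started in $x>b$ let $Y_n:=X_{\sigma_n}$, $n\ge0$ (defined almost surely). i) If $\mathbb{P}_x(\lim_{n\to\infty}Y_n=\infty)=1$ for all $x>b$ and there exist $r,R>0$ and $c<1$ such that $$\sup_{y\in[b-r,b+r],\,y\ne b}\mathbb{P}_y(X_{\sigma_1}>b+R)<c,$$ then $b$ is locally transient. ii) If $\mathbb{P}_x(\liminf_{n\to\infty}Y_n=b)=1$ for all $x>b$, then $b$ is locally recurrent. iii) If $\mathbb{P}_x(\lim_{n\to\infty}Y_n=b)=1$ for all $x>b$ and there exist $r',R'>0$ and $c<1$ such that $$\sup_{y\ge b+r'}\mathbb{P}_y(X_{\sigma_1}<b+R')<c,$$ then $b$ is left limit recurrent.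
   Context: Processes are time homogeneous strong Markov processes with càdlàg paths, with filtration satisfying the usual conditions; $\mathbb{P}_x$ denotes the law of the process started in $x$, and ''a.s.'' means $\mathbb{P}_x$-a.s. for every $x$. $\inf\emptyset=\infty$. With respect to $(X_t)_{t\ge0}$ a point $b$ is called: - left limit recurrent if $\mathbb{P}_b(\forall T>0\ \exists t>T:\ X_{t-}=b)=1$; - locally recurrent if $\mathbb{P}_b(\liminf_{t\to\infty}|X_t-b|=0)=1$; - locally transient if $\mathbb{P}_b(\liminf_{t\to\infty}|X_t-b|=0)<1$. *)

(* Defs.v *)
From mathcomp Require Export all_boot all_order all_algebra.
From mathcomp Require Export all_classical all_reals all_analysis.
From mathcomp Require Export measurable_realfun.

Export Order.TTheory GRing.Theory Num.Theory.
Export numFieldNormedType.Exports.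

#[export] Set Implicit Arguments.
#[export] Unset Strict Implicit.
#[export] Unset Printing Implicit Defensive.

Local Open Scope classical_set_scope.
Local Open Scope ring_scope.

(* Time is [0, oo[, encoded as the nonnegative part of R: in everything below a
   family indexed by time (filtration, process, path) is only constrained at,
   and only inspected at, times t with 0 <= t. *)

Section Process.
Context (d : measure_display) (Omega : measurableType d) (R : realType).
Implicit Types (P : R -> probability Omega R) (F : R -> set (set Omega)).
Implicit Types (X : R -> Omega -> R) (S : Omega -> \bar R).

Record is_filtration F : Prop := IsFiltration {
  filtration_sigma_algebra :
    forall t, 0 <= t -> sigma_algebra [set: Omega] (F t);
  filtration_measurable : forall t, 0 <= t -> F t `<=` measurable;
  filtration_nondecreasing : forall s t, 0 <= s -> s <= t -> F s `<=` F t }.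

(* A null set of the family (P x)_x is a set that is null under every P x, in
   accordance with "a.s." meaning "P x-a.s. for every x". *)
Record usual_conditions P F : Prop := UsualConditions {
  usual_right_continuous :
    forall t, 0 <= t -> F t = \bigcap_(s in [set s | t < s]) F s;
  usual_complete :
    forall N, (forall x, (P x).-negligible N) -> F 0 N }.

Definition adapted F X : Prop :=
  forall t (B : set R), 0 <= t -> measurable B -> F t (X t @^-1` B).

Definition cadlag (f : R -> R) : Prop :=
  (forall t, 0 <= t -> f s @[s --> t^'+] --> f t) /\
  (forall t, 0 < t -> cvg (f s @[s --> t^'-])).

(* The product sigma-algebra on paths, generated by the coordinates f |-> f t
   with 0 <= t. *)
Definition path_measurable : set (set (R -> R)) :=
  <<s [set C | exists t (B : set R),
         [/\ 0 <= t, measurable B & C = [set f | B (f t)]] ] >>.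

Definition stopping_time F S : Prop :=
  (forall w, (0 <= S w)%E) /\
  (forall t, 0 <= t -> F t [set w | (S w <= t%:E)%E]).

(* The sigma-algebra F_S of the events prior to S. *)
Definition stopped_events F S : set (set Omega) :=
  [set A | measurable A /\
           forall t, 0 <= t -> F t (A `&` [set w | (S w <= t%:E)%E])].

Definition path_law P X (C : set (R -> R)) (x : R) : \bar R :=
  P x [set w | C (fun t => X t w)].

(* On [set w | S w < +oo], the conditional law of (X_(S + t))_(t >= 0) given F_S
   under P x is the law of X under P y, with y := X_S. *)
Definition strong_markov_property P F X : Prop :=
  forall x S A C, stopping_time F S -> stopped_events F S A ->
    path_measurable C ->
    P x (A `&` [set w | (S w < +oo)%E /\ C (fun t => X (fine (S w) + t) w)]) =
    (\int[P x]_(w in A `&` [set w | S w < +oo])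
        path_law P X C (X (fine (S w)) w))%E.

Record strong_markov_process P F X : Prop := StrongMarkovProcess {
  process_filtration : is_filtration F;
  process_usual : usual_conditions P F;
  process_adapted : adapted F X;
  process_cadlag : forall w, cadlag (fun t => X t w);
  process_start : forall x, P x [set w | X 0 w = x] = 1%E;
  process_kernel : forall C, path_measurable C ->
    measurable_fun [set: R] (path_law P X C);
  process_strong_markov : strong_markov_property P F X }.

(* inf {t >= s | X_t w \in B}; the infimum of the empty set is +oo. *)
Definition hitting_from X (B : set R) (s : \bar R) (w : Omega) : \bar R :=
  ereal_inf [set t%:E | t in [set t | [/\ 0 <= t, (s <= t%:E)%E & B (X t w)]]].

Definition hitting X (B : set R) (w : Omega) : \bar R := hitting_from X B 0%E w.

(* sigma_n; the inner hitting time is tau_(n+1). *)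
Fixpoint crossing X (b : R) (n : nat) (w : Omega) : \bar R :=
  if n is m.+1 then
    hitting_from X `]b, +oo[ (hitting_from X `]-oo, b[ (crossing X b m w) w) w
  else 0%E.

(* The event that S is finite and X_S \in B. *)
Definition lands X S (B : set R) : set Omega :=
  [set w | (S w < +oo)%E /\ B (X (fine (S w)) w)].

(* Y_n = X_(sigma_n); meaningful where sigma_n is finite, hence almost surely for
   an oscillating process. *)
Definition overshoot X (b : R) (n : nat) (w : Omega) : R :=
  X (fine (crossing X b n w)) w.

Definition oscillating P X : Prop := forall x,
  {ae P x, forall w, limf_esup (fun t => (X t w)%:E) +oo%R = +oo%E} /\
  {ae P x, forall w, limf_einf (fun t => (X t w)%:E) +oo%R = -oo%E}.

(* The set of outcomes need not be measurable a priori; probability one means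
   that its complement is contained in a null event. *)
Definition left_limit_recurrent P X (b : R) : Prop :=
  {ae P b, forall w, forall T, 0 < T ->
     exists t, T < t /\ X s w @[s --> t^'-] --> b}.

Definition approaches X (b : R) : set Omega :=
  [set w | limf_einf (fun t => `|X t w - b|%:E) +oo%R = 0%E].

Definition locally_recurrent P X (b : R) : Prop := P b (approaches X b) = 1%E.

Definition locally_transient P X (b : R) : Prop :=
  (P b (approaches X b) < 1)%E.

End Process.

(* Main.v *)
Require Import Defs.
From mathcomp Require Import lra.

(* Only the Markov property at deterministic times is needed.

   Conditioning successively at finitely many ordered rational times shows that, if
   P_y(C) >= a for all y in V, then from any start
     a P(X visits V at arbitrarily large times)
       <= P(C holds for the path restarted at arbitrarily large times spent in V).

   (i) Take for V a punctured neighbourhood of b and for C the event that the next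
   overshoot is at most b + rho. As Y_n -> oo forces sigma_n -> oo (paths have left
   limits), the event on the right is null from every x > b. By the hypotheses on
   tau^b and sigma^b, the path cannot approach b by hitting b only.

   (ii) From every x > b, and hence from every x, each neighbourhood of b is visited
   almost surely; restart at all integer times.

   (iii) Take V = ]b + r', oo[, visited at arbitrarily large times, and for C the
   event that the next overshoot is at least b + rho'. As Y_n -> b, the crossings of b
   cluster at a finite time with probability at least a := 1 - c, from x > b and
   then from every x. With p the probability of an accumulation and p_n that of one
   before time n, restarting at n gives p >= p_n + a (1 - p_n), whence p = 1. At an
   accumulation time of crossings the left limit is b. *)

Local Open Scope classical_set_scope.
Local Open Scope ring_scope.

(** * Restarted paths, hitting times of a single path, and consequences of right-continuity *)

Section Paths.
Context (R : realType).
Implicit Types (f : R -> R) (B : set R) (s t q : R) (S : \bar R).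

Definition shift q f : R -> R := fun t => f (q + t).

(** The same infimum as in [hitting_from], taken on a bare path so that it can be applied to
    restarted paths and studied on path space. *)
Definition debut f B S : \bar R :=
  ereal_inf [set t%:E | t in [set t | [/\ 0 <= t, (S <= t%:E)%E & B (f t)]]].

Definition path_lands f S B : Prop := (S < +oo)%E /\ B (f (fine S)).

(** Equalities between hitting times are proved through their strict real upper bounds, which have
    witnesses by [debut_lt]; the value +oo then needs no separate treatment. *)
Lemma ereal_eq_lt (x y : \bar R) :
  (forall t : R, (x < t%:E)%E <-> (y < t%:E)%E) -> x = y.
Proof.
wlog xy : x y / (x <= y)%E.
  move=> H h; case/orP: (le_total x y) => ?; first exact: H.
  by apply/esym/H => // t; split => /h.
move=> h; apply/eqP; rewrite eq_le xy /=; apply: contrapT => /negP.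
rewrite -ltNge => lt_xy.
suff [t [xt ty]] : exists t : R, (x < t%:E)%E /\ (t%:E <= y)%E.
  by move/h : xt; rewrite ltNge ty.
case: x y xy h lt_xy => [x| |] [y| |]//= _ _; rewrite ?lte_fin => lt_xy.
- by exists ((x + y) / 2); rewrite lte_fin lee_fin midf_lt// midf_le// ltW.
- by exists (x + 1); rewrite lte_fin ltrDl leey.
- by exists y; rewrite ltNyr.
- by exists 0; rewrite ltNyr leey.
Qed.

Lemma debut_lt f B S t : (debut f B S < t%:E)%E <->
  exists u, [/\ 0 <= u, (S <= u%:E)%E, B (f u) & u < t].
Proof.
split.
  by move=> /ereal_inf_lt[_ [u [u0 Su Bu] <-]]; rewrite lte_fin; exists u.
move=> [u [u0 Su Bu ut]]; apply: (@le_lt_trans _ _ u%:E); last by rewrite lte_fin.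
by apply: ereal_inf_lbound; exists u.
Qed.

Lemma debut_le f B S u : 0 <= u -> (S <= u%:E)%E -> B (f u) ->
  (debut f B S <= u%:E)%E.
Proof. by move=> u0 Su Bu; apply: ereal_inf_lbound; exists u. Qed.

Lemma debut_ge f B S : (S <= debut f B S)%E.
Proof. by apply: le_ereal_inf_tmp => _ [u [_ Su _] <-]. Qed.

Lemma debut_ge0 f B S : (0 <= debut f B S)%E.
Proof. by apply: le_ereal_inf_tmp => _ [u [u0 _ _] <-]; rewrite lee_fin. Qed.

Lemma debut_fineK f B S : (debut f B S < +oo)%E ->
  (fine (debut f B S))%:E = debut f B S.
Proof. by move=> ?; rewrite fineK// ge0_fin_numE// debut_ge0. Qed.

(** Delaying the start of the search, but not beyond the first hit, skips no visit to [B]. *)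
Lemma debut_eq f B S S' : (S <= S')%E -> (S' <= debut f B S)%E ->
  debut f B S' = debut f B S.
Proof.
move=> SS' S'd; apply: ereal_eq_lt => t; split => /debut_lt[u [u0 Su Bu ut]];
  apply/debut_lt; exists u; split => //.
  exact: le_trans SS' Su.
by apply: (le_trans S'd); exact: debut_le.
Qed.

Lemma debut_shift f B S q : 0 <= q -> (0 <= S)%E ->
  (q%:E + debut (shift q f) B S = debut f B (q%:E + S))%E.
Proof.
move=> q0 S0; apply: ereal_eq_lt => t.
rewrite -lteBrDl// -EFinB; split => /debut_lt[u [u0 Su Bu ut]]; apply/debut_lt.
  exists (q + u); split; [exact: addr_ge0| |exact: Bu|by rewrite -ltrBrDl].
  by rewrite EFinD leeD2l.
exists (u - q); split.
- rewrite subr_ge0 -lee_fin (le_trans _ Su)//.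
  by rewrite leeDl.
- by rewrite EFinB leeBrDl.
- by rewrite /shift addrC subrK.
- by rewrite ltrBrDl addrC subrK.
Qed.

Lemma add_at_right q t : (q + s) @[s --> t^'+] --> (q + t)^'+.
Proof.
move=> A [e /= e0 eA]; exists e => //= s /=; rewrite /ball/= => ste ts.
by apply: eA; rewrite /= ?ltrD2l// /ball/= opprD addrACA subrr add0r.
Qed.

Lemma add_at_left q t : (q + s) @[s --> t^'-] --> (q + t)^'-.
Proof.
move=> A [e /= e0 eA]; exists e => //= s /=; rewrite /ball/= => ste ts.
by apply: eA; rewrite /= ?ltrD2l// /ball/= opprD addrACA subrr add0r.
Qed.

Lemma cadlag_shift f q : 0 <= q -> cadlag f -> cadlag (shift q f).
Proof.
move=> q0 [fr fl]; split => t t0.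
  exact: cvg_comp (@add_at_right q t) (fr _ (addr_ge0 q0 t0)).
apply/cvg_ex; have /cvg_ex[l fl'] := fl _ (ltr_wpDl q0 t0); exists l.
exact: cvg_comp (@add_at_left q t) fl'.
Qed.

Lemma cadlag_right f B t : cadlag f -> 0 <= t -> open B -> B (f t) ->
  exists2 e, 0 < e & forall s, t <= s -> s < t + e -> B (f s).
Proof.
move=> [cf _] t0 oB Bt; have /(_ B) := cf t t0.
have nB : nbhs (f t) B by exact: open_nbhs_nbhs.
move=> /(_ nB); rewrite /= => /= -[e /= e0 eB]; exists e => // s.
rewrite le_eqVlt => /orP[/eqP <-//|ts] ste.
by apply: eB => //=; rewrite /ball /= distrC ger0_norm ?subr_ge0 ?(ltW ts)// ltrBlDl.
Qed.

(** An open condition satisfied at [s] persists on an interval to the right of [s], and that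
    interval contains a rational. This is how arbitrary times are replaced by countably many. *)
Lemma cadlag_rat f B s t : cadlag f -> 0 <= s -> s < t -> open B -> B (f s) ->
  exists q : rat, [/\ s < ratr q, ratr q < t & B (f (ratr q))].
Proof.
move=> cf s0 st oB /(cadlag_right cf s0 oB)[e e0 eB].
have : s < Num.min t (s + e) by rewrite lt_min st ltrDl.
move=> /rat_in_itvoo[q]; rewrite in_itv /= lt_min => /andP[sq /andP[qt qe]].
by exists q; split => //; apply: eB => //; exact: ltW.
Qed.

Lemma cadlag_closed f B t : cadlag f -> 0 <= t -> closed B ->
  (forall e, 0 < e -> exists s, [/\ t <= s, s < t + e & B (f s)]) -> B (f t).
Proof.
move=> cf t0 cB H; apply: contrapT => nB.
have [e e0 eB] := cadlag_right cf t0 (closed_openC cB) nB.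
by have [s [ts st Bs]] := H e e0; exact: eB ts st Bs.
Qed.

(** The hitting time is either attained or a limit from the right of times spent in [B], so by
    right-continuity the path lands in every closed set containing [B]. *)
Lemma debut_closure f B C S : cadlag f -> closed C -> B `<=` C ->
  (debut f B S < +oo)%E -> C (f (fine (debut f B S))).
Proof.
move=> cf cC BC fin; apply: (@cadlag_closed f C) => //.
  by rewrite fine_ge0// debut_ge0.
move=> e e0; have : (debut f B S < (fine (debut f B S) + e)%:E)%E.
  by rewrite EFinD debut_fineK// lteDl ?lte_fin// -debut_fineK.
move=> /debut_lt[u [u0 Su Bu ut]]; exists u; split => //; last exact: BC.
by rewrite -lee_fin debut_fineK// debut_le.
Qed.

End Paths.

(** * Upcrossing times of a path and their accumulation *)

Section Crossings.
Context (R : realType).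
Implicit Types (f : R -> R) (A B C D : set R) (s t q b M : R) (S : \bar R).

Lemma open_below b : open [set` `]-oo, b[]. Proof. exact: interval_open. Qed.

Lemma open_above b : open [set` `]b, +oo[]. Proof. exact: interval_open. Qed.

Lemma debut_lt_rat f B S t : cadlag f -> open B -> (0 <= S)%E ->
  (debut f B S < t%:E)%E <-> exists q : rat,
    [/\ 0 < ratr q :> R, (S < (ratr q)%:E)%E, B (f (ratr q)) & ratr q < t].
Proof.
move=> cf oB S0; split=> [/debut_lt[u [u0 Su Bu ut]]|[q [q0 Sq Bq qt]]].
  have [q [uq qt Bq]] := cadlag_rat cf u0 ut oB Bu.
  exists q; split => //; first exact: le_lt_trans uq.
  by apply: le_lt_trans Su _; rewrite lte_fin.
by apply/debut_lt; exists (ratr q); split => //; exact: ltW.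
Qed.

Lemma addl_ltpinfty (r : R) (x : \bar R) : (r%:E + x < +oo)%E -> (x < +oo)%E.
Proof. by case: x => [x| |] //; rewrite ?ltry ?ltNyr // ltxx. Qed.

(** The time sigma_k as a functional of the path; [crossing] is its value on the path of an
    outcome. *)
Fixpoint up_crossing f b (k : nat) : \bar R :=
  if k is m.+1 then debut f `]b, +oo[ (debut f `]-oo, b[ (up_crossing f b m))
  else 0%E.

Arguments up_crossing : simpl never.

Lemma up_crossingS f b k : up_crossing f b k.+1 =
  debut f `]b, +oo[ (debut f `]-oo, b[ (up_crossing f b k)).
Proof. by []. Qed.

(** Pathwise form of the oscillation hypothesis; it makes every crossing time finite. *)
Definition unbounded_both_sides f : Prop := forall M T,
  (exists2 t, T <= t & M < f t) /\ (exists2 t, T <= t & f t < M).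

Lemma up_crossing_ge0 f b k : (0 <= up_crossing f b k)%E.
Proof. by case: k => [|k] //=; exact: debut_ge0. Qed.

Lemma up_crossing_nd f b k : (up_crossing f b k <= up_crossing f b k.+1)%E.
Proof. exact: le_trans (debut_ge _ _ _) (debut_ge _ _ _). Qed.

Lemma up_crossing_ndW f b k l : (k <= l)%N ->
  (up_crossing f b k <= up_crossing f b l)%E.
Proof.
by move=> /subnK <-; elim: (l - k)%N => // m /le_trans; apply; exact: up_crossing_nd.
Qed.

Lemma debut_fin f B S : (0 <= S)%E -> (S < +oo)%E ->
  (forall T, exists2 t, T <= t & B (f t)) -> (debut f B S < +oo)%E.
Proof.
move=> S0 Sfin H; have [t St Bt] := H (fine S).
have Sf : (fine S)%:E = S by rewrite fineK// ge0_fin_numE.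
apply: (@le_lt_trans _ _ t%:E); last exact: ltry.
apply: debut_le => //; last by rewrite -Sf lee_fin.
by rewrite (le_trans _ St)// fine_ge0.
Qed.

Lemma down_fin f b S : unbounded_both_sides f -> (0 <= S)%E -> (S < +oo)%E ->
  (debut f `]-oo, b[ S < +oo)%E.
Proof.
move=> uf S0 Sfin; apply: debut_fin => // T; have [_ [t Tt tb]] := uf b T.
by exists t => //; rewrite /= in_itv.
Qed.

Lemma up_fin f b S : unbounded_both_sides f -> (0 <= S)%E -> (S < +oo)%E ->
  (debut f `]b, +oo[ S < +oo)%E.
Proof.
move=> uf S0 Sfin; apply: debut_fin => // T; have [[t Tt tb] _] := uf b T.
by exists t => //; rewrite /= in_itv/= andbT.
Qed.

Lemma up_crossing_fin f b k : unbounded_both_sides f -> (up_crossing f b k < +oo)%E.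
Proof.
move=> uf; elim: k => [|k IH]; first exact: ltry.
apply: up_fin => //; first exact: debut_ge0.
by apply: down_fin => //; exact: up_crossing_ge0.
Qed.

Lemma up_crossing_fineK f b k : unbounded_both_sides f ->
  (fine (up_crossing f b k))%:E = up_crossing f b k.
Proof.
by move=> /up_crossing_fin uf; rewrite fineK// ge0_fin_numE ?uf// up_crossing_ge0.
Qed.

(** If the path is above [b] at [q], then tau_(k+1) cannot precede [q], since otherwise sigma_(k+1)
    would be at most [q]; so both searches restart unchanged. If it is below [b], the restarted path
    has tau_1 = 0, and [q] lies between tau_(k+1) and sigma_(k+1). *)
Lemma up_crossing1_shift f b q k : 0 <= q -> f q <> b ->
  (up_crossing f b k <= q%:E)%E -> (q%:E < up_crossing f b k.+1)%E ->
  (q%:E + up_crossing (shift q f) b 1 = up_crossing f b k.+1)%E.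
Proof.
move=> q0 fqb kq; rewrite 2!up_crossingS [up_crossing _ _ 0]/up_crossing => qk.
rewrite debut_shift ?debut_ge0// debut_shift// adde0.
set d := debut f `]-oo, b[ (up_crossing f b k).
have [bfq|] := ltP b (f q).
  suff qd : (q%:E <= d)%E by rewrite (debut_eq kq qd).
  rewrite leNgt; apply/negP => dq; move: qk; rewrite ltNge => /negP; apply.
  by apply: debut_le => //; [exact: ltW|rewrite /= in_itv/= andbT].
rewrite le_eqVlt => /orP[/eqP//|fqb'].
have -> : debut f `]-oo, b[ q%:E = q%:E.
  by apply/eqP; rewrite eq_le debut_ge andbT debut_le//= in_itv.
apply: debut_eq; last exact: ltW.
by apply: debut_le => //=; rewrite in_itv.
Qed.

Lemma up_crossing_between f b q : 0 <= q ->
  (exists n, (q%:E < up_crossing f b n)%E) ->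
  exists k, (up_crossing f b k <= q%:E)%E /\ (q%:E < up_crossing f b k.+1)%E.
Proof.
move=> q0 ex; case: (ex_minnP ex) => -[|k] qk kmin.
  by move: qk; rewrite /up_crossing lte_fin ltNge q0.
exists k; split => //; rewrite leNgt; apply/negP => /kmin.
by rewrite ltnn.
Qed.

(** Every late time lies between two successive crossings of high index, so the first overshoot of
    the path restarted there is one of the later overshoots of the original path. *)
Lemma lands_shift_up_crossing f b B n0 : unbounded_both_sides f ->
  (forall T, exists n, (T%:E <= up_crossing f b n)%E) ->
  (forall n, (n0 <= n)%N -> B (f (fine (up_crossing f b n)))) ->
  exists N : nat, forall q, N%:R <= q -> f q <> b ->
    path_lands (shift q f) (up_crossing (shift q f) b 1) B.
Proof.
move=> uf infty evB.
have [N hN] : exists N : nat, fine (up_crossing f b n0) <= N%:R.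
  by eexists; exact: ltW (archi_boundP (fine_ge0 (up_crossing_ge0 f b n0))).
exists N => q Nq fqb.
have q0 : 0 <= q by rewrite (le_trans _ Nq).
have [k [kq qk]] : exists k, (up_crossing f b k <= q%:E)%E /\ (q%:E < up_crossing f b k.+1)%E.
  apply: up_crossing_between => //; have [n hn] := infty (q + 1).
  by exists n; apply: lt_le_trans hn; rewrite lte_fin ltrDl.
have e := up_crossing1_shift q0 fqb kq qk.
(* [N] bounds sigma_n0, so a restart after [N] can only be followed by a crossing of index at least
   [n0]. *)
have n0k : (n0 <= k.+1)%N.
  rewrite leqNgt; apply/negP => /ltnW/(up_crossing_ndW f b) kn0.
  move: qk; rewrite ltNge => /negP; apply; apply: (le_trans kn0).
  by rewrite -up_crossing_fineK// lee_fin (le_trans hN).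
have fin1 : (up_crossing (shift q f) b 1 < +oo)%E.
  by apply: (@addl_ltpinfty q); rewrite e; exact: up_crossing_fin.
split => //; have := evB _ n0k; rewrite -e fineD// ge0_fin_numE//.
exact: up_crossing_ge0.
Qed.

(** The condition sigma_k < t, written with values at rational times strictly between 0 and [t], so
    that it is visibly an event known at time [t]. *)
Fixpoint crossed f b (k : nat) t : Prop :=
  if k is m.+1 then exists p q : rat,
    [/\ 0 < ratr p :> R, ratr p < ratr q :> R & ratr q < t] /\
    [/\ crossed f b m (ratr p), f (ratr p) < b & b < f (ratr q)]
  else True.

Arguments crossed : simpl never.

Lemma crossedP f b k t : cadlag f -> 0 < t ->
  crossed f b k t <-> (up_crossing f b k < t%:E)%E.
Proof.
move=> cf; elim: k t => [|k IH] t t0; first by rewrite lte_fin.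
rewrite up_crossingS; split.
  move=> [p [q [[p0 pq qt] [/(IH _ p0) kp fp fq]]]].
  apply: (debut_lt_rat _ cf (@open_above b) (debut_ge0 _ _ _)).2; exists q.
  split; [exact: lt_trans pq| |by rewrite /= in_itv/= andbT|by []].
  apply: (debut_lt_rat _ cf (@open_below b) (up_crossing_ge0 _ _ _)).2; exists p.
  by rewrite /= in_itv.
move=> /((debut_lt_rat _ cf (@open_above b) (debut_ge0 _ _ _)).1)[q [q0 + fq qt]].
move=> /((debut_lt_rat _ cf (@open_below b) (up_crossing_ge0 _ _ _)).1)[p [p0 kp fp pq]].
exists p, q; split; split => //.
- exact/(IH _ p0).
- by move: fq; rewrite /= in_itv/= andbT.
Qed.

Lemma cadlag_left f t : cadlag f -> 0 < t -> exists2 l : R, f s @[s --> t^'-] --> l &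
  forall B, open B -> B l -> exists2 e : R, 0 < e &
    forall s, t - e < s -> s < t -> B (f s).
Proof.
move=> [_ cf] /cf /cvg_ex[l fl]; exists l => // B oB Bl.
have nB : nbhs l B by exact: open_nbhs_nbhs.
have [e /= e0 eB] := fl B nB; exists e => // s tes st.
apply: eB => //=; rewrite /ball /= ger0_norm ?subr_ge0 ?(ltW st)//.
by rewrite ltrBlDl -ltrBlDr.
Qed.

(** The path stays in [A] for a while, so the hit is strictly later and is also the first hit after
    some rational time spent in [A]. Landing in [C] outside [B] is excluded for the path restarted
    at that rational time. In the application [A] and [B] are the two open half-lines at [b], and
    [C] is the closure of [B]. *)
Lemma debut_separated f A B C (u : R) : cadlag f -> 0 <= u -> open A -> closed C ->
  B `<=` C -> (forall x, A x -> ~ C x) ->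
  (forall q : rat, 0 <= ratr q :> R -> A (f (ratr q)) ->
     ~ path_lands (shift (ratr q) f) (debut (shift (ratr q) f) B 0) (C `\` B)) ->
  A (f u) -> (debut f B u%:E < +oo)%E ->
  (u%:E < debut f B u%:E)%E /\ B (f (fine (debut f B u%:E))).
Proof.
move=> cf u0 oA cC BC AC H Au fin.
have [e e0 eA] := cadlag_right cf u0 oA Au.
have ue : ((u + e)%:E <= debut f B u%:E)%E.
  apply: le_ereal_inf_tmp => _ [v [v0 uv Bv] <-]; rewrite lee_fin leNgt; apply/negP => ve.
  by apply: (AC (f v)); [exact: eA|exact: BC].
split; first by apply: lt_le_trans ue; rewrite lte_fin ltrDl.
have [q [uq qe Aq]] : exists q : rat, [/\ u < ratr q, ratr q < u + e & A (f (ratr q))].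
  by apply: (@cadlag_rat _ f A u (u + e)) => //; rewrite ltrDl.
have q0 : 0 <= ratr q :> R by rewrite (le_trans u0)// ltW.
have dq : debut f B (ratr q)%:E = debut f B u%:E.
  by apply: debut_eq; [rewrite lee_fin ltW|rewrite (le_trans _ ue)// lee_fin ltW].
apply: contrapT => nB; apply: (H q q0 Aq).
have := @debut_shift _ f B 0%E _ q0 (lexx _); rewrite adde0 dq => e1.
have fin1 : (debut (shift (ratr q) f) B 0 < +oo)%E.
  by apply: (@addl_ltpinfty (ratr q)); rewrite e1.
split => //.
suff -> : shift (ratr q) f (fine (debut (shift (ratr q) f) B 0)) =
    f (fine (debut f B u%:E)).
  by split => //; exact: (@debut_closure _ f B C).
by rewrite /shift -e1 fineD// ge0_fin_numE// debut_ge0.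
Qed.

(* The times sigma_1 < sigma_2 < ... cluster before M; the witnesses t <= M make
   this an event known at time M. *)
Definition clusters_by f b (M : R) : Prop := forall k, crossed f b k.+1 M /\
  exists t : rat, [/\ 0 < ratr t :> R, ratr t <= M, crossed f b k.+1 (ratr t) &
    ~ crossed f b k.+2 (ratr t)].

(** The rational witness separates two successive crossings: sigma_(k+1) < t <= sigma_(k+2). It
    certifies that the crossing times increase strictly. *)
Lemma clusters_byP f b M : cadlag f -> 0 < M ->
  clusters_by f b M <-> forall k, (up_crossing f b k.+1 < M%:E)%E /\
    (up_crossing f b k.+1 < up_crossing f b k.+2)%E.
Proof.
move=> cf M0; split=> [H k|H k].
  have [kM [t [t0 tM kt k2t]]] := H k; split; first exact: (crossedP _ _ cf M0).1.
  apply: (@lt_le_trans _ _ (ratr t)%:E); first exact: (crossedP _ _ cf t0).1.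
  by rewrite leNgt; apply/negP => /(crossedP _ _ cf t0).
have [kM kk] := H k; have [k2M _] := H k.+1; split; first exact/crossedP.
have finK n : (up_crossing f b n.+1)%E = (fine (up_crossing f b n.+1))%:E.
  have [nM _] := H n; rewrite fineK// ge0_fin_numE; last exact: up_crossing_ge0.
  by apply: lt_trans nM _; exact: ltry.
move: kk k2M; rewrite (finK k) (finK k.+1) !lte_fin => /rat_in_itvoo[t].
rewrite in_itv /= => /andP[kt tk2] k2M.
have t0 : 0 < ratr t :> R.
  exact: le_lt_trans (fine_ge0 (up_crossing_ge0 f b k.+1)) kt.
exists t; split => //; first by rewrite ltW// (lt_trans tk2).
  by apply: (crossedP _ _ cf t0).2; rewrite finK lte_fin.
move=> /((crossedP _ _ cf t0).1); rewrite finK lte_fin => /(lt_trans tk2).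
by rewrite ltxx.
Qed.

(** At the supremum [s] of the crossing times a left limit exists. Immediately before [s] the path
    takes values at least [b] (at the sigma_k) and at most [b] (at the tau_k), so this limit is
    [b]. *)
Lemma left_limit_accumulation f b M : cadlag f -> 0 < M -> clusters_by f b M ->
  exists2 s, 0 < s & f t @[t --> s^'-] --> b.
Proof.
move=> cf M0 /(clusters_byP _ cf M0) H.
pose u k := fine (up_crossing f b k.+1).
have finK n : (up_crossing f b n.+1)%E = (u n)%:E.
  have [nM _] := H n; rewrite fineK// ge0_fin_numE; last exact: up_crossing_ge0.
  by apply: lt_trans nM _; exact: ltry.
have uM n : u n < M by have [+ _] := H n; rewrite finK lte_fin.
have uu n : u n < u n.+1 by have [_] := H n; rewrite !finK lte_fin.
have u0 n : 0 <= u n by rewrite -lee_fin -finK up_crossing_ge0.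
pose s := sup (range u).
have hs : has_sup (range u).
  by split; [exists (u 0%N), 0%N|exists M => _ [n _ <-]; exact: ltW].
(* Strict increase keeps all crossing times strictly to the left of [s], so that only the left limit
   matters. *)
have us n : u n < s.
  by apply: lt_le_trans (uu n) _; apply: ub_le_sup; [exact: hs.2|exists n.+1].
have s0 : 0 < s by exact: le_lt_trans (us 0%N).
exists s => //.
have [l fl lB] := cadlag_left cf s0.
have near_s (e : R) : 0 < e -> exists n, s - e < u n.
  by move=> e0; have [_ [n _ <-] en] := sup_adherent e0 hs; exists n.
pose v n := fine (debut f `]-oo, b[ (u n)%:E).
have dfin n : (debut f `]-oo, b[ (u n)%:E < +oo)%E.
  apply: (@le_lt_trans _ _ (u n.+1)%:E); last exact: ltry.
  by rewrite -!finK [X in (_ <= X)%E]up_crossingS; exact: debut_ge.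
have vE n : (v n)%:E = debut f `]-oo, b[ (u n)%:E by exact: debut_fineK.
have uv n : u n <= v n by rewrite -lee_fin vE debut_ge.
have vu n : v n <= u n.+1.
  by rewrite -lee_fin vE -!finK [X in (_ <= X)%E]up_crossingS; exact: debut_ge.
have fv n : f (v n) <= b.
  apply: (@debut_closure _ f `]-oo, b[ [set x | x <= b]) => //.
  by move=> x /=; rewrite in_itv/=; exact: ltW.
have fu n : b <= f (u n).
  apply: (@debut_closure _ f `]b, +oo[ [set x | b <= x]) => //.
    by move=> x /=; rewrite in_itv/= andbT; exact: ltW.
  by rewrite -up_crossingS finK; exact: ltry.
suff <- : l = b by [].
apply/eqP; rewrite eq_le !leNgt; apply/andP; split; apply/negP => lb.
  have [|e e0 eB] := lB _ (@open_above b); first by rewrite /= in_itv/= lb.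
  have [n en] := near_s e e0; have vs := le_lt_trans (vu n) (us n.+1).
  have := eB (v n) (lt_le_trans en (uv n)) vs.
  by rewrite /= in_itv/= andbT; apply/negP; rewrite -leNgt.
have [|e e0 eB] := lB _ (@open_below b); first by rewrite /= in_itv/= lb.
have [n en] := near_s e e0; have := eB (u n) en (us n).
by rewrite /= in_itv/=; apply/negP; rewrite -leNgt.
Qed.

End Crossings.

(** * Pathwise arguments: reaching [b] exactly, divergence and clustering of crossings *)

Section CrossingPaths.
Context (R : realType).
Implicit Types (f : R -> R) (A B C D : set R) (s t q b M : R) (S : \bar R).

(** Only rational times occur, which makes this a measurable condition; it is a witness that the
    first exit from [A] happens at [b]. *)
Definition touches f A b : Prop := A (f 0) /\ exists q : rat,
  [/\ 0 <= ratr q :> R, f (ratr q) = b &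
   forall s : rat, 0 <= ratr s :> R -> ratr s <= ratr q :> R ->
     A (f (ratr s)) \/ f (ratr s) = b].

(** At the exit time the value is outside the open set [A]; it is also [b], or a limit from the
    right of values in the closed set [A] together with [b]. Hence it is [b]. *)
Lemma touches_lands f A b : cadlag f -> open A -> closed (A `|` [set b]) -> ~ A b ->
  touches f A b -> path_lands f (debut f (~` A) 0) [set b].
Proof.
move=> cf oA cA nAb [_ [q [q0 fq fA]]].
have dq : (debut f (~` A) 0 <= (ratr q)%:E)%E by apply: debut_le => //=; rewrite fq.
have dfin := le_lt_trans dq (ltry _).
split => //; set d := fine _.
have d0 : 0 <= d by rewrite fine_ge0// debut_ge0.
have nAd : (~` A) (f d) by apply: debut_closure => //; exact: open_closedC.
suff : (A `|` [set b]) (f d) by case=> // /nAd.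
have : d <= ratr q by rewrite -lee_fin debut_fineK.
rewrite le_eqVlt => /orP[/eqP ->|ltdq]; first by right.
apply: cadlag_closed => // e e0.
have : d < Num.min (ratr q) (d + e) by rewrite lt_min ltdq ltrDl.
move=> /rat_in_itvoo[p]; rewrite in_itv /= lt_min => /andP[dp /andP[pq pe]].
exists (ratr p); split => //; first exact: ltW.
by apply: fA; [exact: le_trans d0 (ltW _)|exact: ltW].
Qed.

(** Passes from the open half-line [B], used by the crossing times, to the closed one, used by the
    hypotheses on tau^b and sigma^b. If the closed half-line were first entered inside [B], the two
    hitting times would agree and the path would land in [B] instead of at [b]. *)
Lemma creeps_lands f A B b : cadlag f -> open A -> B `<=` ~` A ->
  ~` A `<=` B `|` [set b] -> ~ B b ->
  path_lands f (debut f B 0) [set b] -> path_lands f (debut f (~` A) 0) [set b].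
Proof.
move=> cf oA BA AB nBb [Bfin fb].
have dd : (debut f (~` A) 0 <= debut f B 0)%E.
  apply: le_ereal_inf_tmp => _ [u [u0 Su Bu] <-].
  by apply: debut_le => //; exact: BA.
have dfin := le_lt_trans dd Bfin; split => //.
have nAd : (~` A) (f (fine (debut f (~` A) 0))).
  by apply: debut_closure => //; exact: open_closedC.
case: (AB _ nAd) => // Bd; exfalso; apply: nBb; rewrite -fb.
suff -> : debut f B 0 = debut f (~` A) 0 by [].
apply/eqP; rewrite eq_le dd andbT -[X in (_ <= X)%E]debut_fineK//; apply: debut_le => //.
  by rewrite fine_ge0// debut_ge0.
by rewrite lee_fin fine_ge0// debut_ge0.
Qed.

Definition creeps f b : Prop :=
  (b < f 0 /\ path_lands f (debut f `]-oo, b[ 0) [set b]) \/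
  (f 0 < b /\ path_lands f (debut f `]b, +oo[ 0) [set b]).

(** Without creeping each crossing lands strictly on the other side of [b], and by right-continuity
    the next one then takes a positive time. *)
Lemma up_crossing_strict f b k : cadlag f -> unbounded_both_sides f -> b < f 0 ->
  (forall q : rat, 0 <= ratr q :> R -> ~ creeps (shift (ratr q) f) b) ->
  (up_crossing f b k < up_crossing f b k.+1)%E.
Proof.
move=> cf uf bf0 nc.
have down (u : R) : 0 <= u -> b < f u -> (u%:E < debut f `]-oo, b[ u%:E)%E /\
    f (fine (debut f `]-oo, b[ u%:E)) < b.
  move=> u0 bfu.
  have -> : forall y, (y < b) = (`]-oo, b[%classic y) :> Prop.
    by move=> y; rewrite /= in_itv.
  apply: (@debut_separated _ f `]b, +oo[ _ [set x | x <= b]) => //.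
  - by move=> x /=; rewrite in_itv/=; exact: ltW.
  - by move=> x /=; rewrite in_itv/= andbT ltNge => /negP.
  - move=> q q0; rewrite /= in_itv/= andbT => bfq [fin [/= le_b]].
    rewrite in_itv/= => nlt; apply: (nc q q0); left; split.
      by rewrite /shift addr0.
    by split => //=; apply/eqP; rewrite eq_le le_b leNgt; apply/negP.
  - by rewrite /= in_itv/= andbT.
  - by apply: down_fin => //; exact: ltry.
have up (u : R) : 0 <= u -> f u < b -> (u%:E < debut f `]b, +oo[ u%:E)%E /\
    b < f (fine (debut f `]b, +oo[ u%:E)).
  move=> u0 bfu.
  have -> : forall y, (b < y) = (`]b, +oo[%classic y) :> Prop.
    by move=> y; rewrite /= in_itv/= andbT.
  apply: (@debut_separated _ f `]-oo, b[ _ [set x | b <= x]) => //.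
  - by move=> x /=; rewrite in_itv/= andbT; exact: ltW.
  - by move=> x /=; rewrite in_itv/= ltNge => /negP.
  - move=> q q0; rewrite /= in_itv/= => bfq [fin [/= le_b]].
    rewrite in_itv/= andbT => nlt; apply: (nc q q0); right; split.
      by rewrite /shift addr0.
    by split => //=; apply/eqP; rewrite eq_le le_b andbT leNgt; apply/negP.
  - by apply: up_fin => //; exact: ltry.
(* The strict position above [b] after a crossing is carried through the induction, since it starts
   the next step. *)
suff : (up_crossing f b k < up_crossing f b k.+1)%E /\ b < f (fine (up_crossing f b k.+1)).
  by case.
have step j : b < f (fine (up_crossing f b j)) ->
    (up_crossing f b j < up_crossing f b j.+1)%E /\ b < f (fine (up_crossing f b j.+1)).
  move=> bfj; have u0 := fine_ge0 (up_crossing_ge0 f b j).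
  have [jd fd] := down _ u0 bfj.
  have dfin := down_fin b uf (up_crossing_ge0 f b j) (up_crossing_fin b j uf).
  have d0 := fine_ge0 (debut_ge0 f `]-oo, b[ (up_crossing f b j)).
  rewrite up_crossing_fineK// in jd fd; have [du fu] := up _ d0 fd.
  by rewrite debut_fineK// in du fu; split => //; exact: lt_trans du.
elim: k => [|k [_ /step]] //; exact: step.
Qed.

(** Bounded nondecreasing times either reach their supremum, and are then constant, or approach it
    strictly from the left, where the path has a finite left limit. *)
Lemma eventually_bounded f (u : nat -> R) M : cadlag f -> (forall n, 0 <= u n) ->
  (forall n, u n <= u n.+1) -> (forall n, u n <= M) ->
  exists (C : R) N, forall n, (N <= n)%N -> f (u n) <= C.
Proof.
move=> cf u0 nd uM.
have ndW m n : (m <= n)%N -> u m <= u n.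
  by move=> /subnK <-; elim: (n - m)%N => // k /le_trans; apply; exact: nd.
pose s := sup (range u).
have hs : has_sup (range u).
  by split; [exists (u 0%N), 0%N|exists M => _ [n _ <-]].
have us n : u n <= s by apply: ub_le_sup; [exact: hs.2|exists n].
have [[N uN]|nu] := pselect (exists n, u n = s).
  exists (f s), N => n Nn; suff -> : u n = s by [].
  by apply/eqP; rewrite eq_le us -uN ndW.
have {}us n : u n < s.
  by rewrite lt_neqAle us andbT; apply/eqP => e; apply: nu; exists n.
have s0 : 0 < s by exact: le_lt_trans (us 0%N).
have [l _ /(_ _ (@open_below _ (l + 1)))[|e e0 eB]] := cadlag_left cf s0.
  by rewrite /= in_itv/= ltrDl.
have [_ [N _ <-] eN] := sup_adherent e0 hs.
exists (l + 1), N => n /ndW Nn; have := eB (u n) (lt_le_trans eN Nn) (us n).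
by rewrite /= in_itv/=; exact: ltW.
Qed.

Lemma up_crossing_unbounded f b : cadlag f -> unbounded_both_sides f ->
  f (fine (up_crossing f b n)) @[n --> \oo] --> +oo ->
  forall T, exists n, (T%:E <= up_crossing f b n)%E.
Proof.
move=> cf uf fy T; apply: contrapT => H.
have [C [N CN]] : exists (C : R) N, forall n, (N <= n)%N -> f (fine (up_crossing f b n)) <= C.
  apply: (@eventually_bounded f (fun n => fine (up_crossing f b n)) T) => // n.
  - exact: fine_ge0 (up_crossing_ge0 f b n).
  - by rewrite -lee_fin !up_crossing_fineK//; exact: up_crossing_nd.
  - rewrite -lee_fin up_crossing_fineK// leNgt; apply/negP => /ltW Tn.
    by apply: H; exists n.
have /cvgryPgt/(_ C)[N' _ HN'] := fy.
have := HN' (maxn N N') (leq_maxr _ _).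
by rewrite /= ltNge CN// leq_maxl.
Qed.

Lemma diverging_overshoots_eventually_big f b c : cadlag f -> unbounded_both_sides f ->
  f (fine (up_crossing f b n)) @[n --> \oo] --> +oo ->
  ~ (forall N : nat, exists q : rat, [/\ N%:R <= ratr q :> R, f (ratr q) <> b &
     ~ path_lands (shift (ratr q) f) (up_crossing (shift (ratr q) f) b 1) `]c, +oo[]).
Proof.
move=> cf uf fy H.
have /cvgryPgt/(_ c)[N' _ HN'] := fy.
have [||N HN] := @lands_shift_up_crossing _ f b `]c, +oo[ N' uf.
- exact: up_crossing_unbounded.
- by move=> n /HN'; rewrite /= in_itv/= andbT.
have [q [Nq fq nl]] := H N; exact: nl (HN _ Nq fq).
Qed.

(** If the crossing times were unbounded, every late restart off [b] would overshoot to a value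
    below [c], contrary to the last hypothesis. So they are bounded, and they increase strictly in
    the absence of creeping. *)
Lemma converging_overshoots_cluster f b c : cadlag f -> unbounded_both_sides f ->
  b < f 0 -> b < c ->
  (forall q : rat, 0 <= ratr q :> R -> ~ creeps (shift (ratr q) f) b) ->
  f (fine (up_crossing f b n)) @[n --> \oo] --> b ->
  (forall N : nat, exists q : rat, [/\ N%:R <= ratr q :> R, f (ratr q) <> b &
     ~ path_lands (shift (ratr q) f) (up_crossing (shift (ratr q) f) b 1) `]-oo, c[]) ->
  exists2 M : rat, 0 < ratr M :> R & clusters_by f b (ratr M).
Proof.
move=> cf uf bf0 bc nc fb H.
have [N' _ HN'] : \forall n \near \oo, f (fine (up_crossing f b n)) < c.
  exact: (cvgr_lt b fb).
have [[T HT]|] := pselect (exists T, forall n, (up_crossing f b n < T%:E)%E); last first.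
  move=> nT; exfalso.
  have [||N HN] := @lands_shift_up_crossing _ f b `]-oo, c[ N' uf.
  - move=> T; apply: contrapT => HT; apply: nT; exists T => n.
    by rewrite ltNge; apply/negP => Tn; apply: HT; exists n.
  - by move=> n /HN'; rewrite /= in_itv/=.
  have [q [Nq fq nl]] := H N; exact: nl (HN _ Nq fq).
(* The bound on sigma_0 = 0 gives the sign of [T]. *)
have T0 : 0 < T by have := HT 0%N; rewrite lte_fin.
have [M] : exists M : rat, ratr M \in `]T, (T + 1)[ by apply: rat_in_itvoo; rewrite ltrDl.
rewrite in_itv/= => /andP[TM _]; have M0 := lt_trans T0 TM.
exists M => //; apply/clusters_byP => // k; split; last exact: up_crossing_strict.
by apply: lt_trans (HT _) _; rewrite lte_fin.
Qed.

(** If a late path came within [r] of [b] only by being equal to [b], then at the start of a stretch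
    spent at [b] it would either touch [b] from one side or already have been at [b]. *)
Lemma approach_avoiding f b (r : R) : cadlag f -> unbounded_both_sides f -> 0 < r ->
  (forall q : rat, 0 <= ratr q :> R -> ~ touches (shift (ratr q) f) `]b, +oo[ b) ->
  (forall q : rat, 0 <= ratr q :> R -> ~ touches (shift (ratr q) f) `]-oo, b[ b) ->
  (forall N e, 0 < e -> exists2 t, N <= t & `|f t - b| < e) ->
  forall N : R, 0 <= N -> exists q : rat,
    [/\ N <= ratr q, f (ratr q) <> b & `|f (ratr q) - b| < r].
Proof.
move=> cf uf r0 nup ndown appr N N0; apply: contrapT => H.
have oU : open [set x : R | `|x - b| < r].
  have -> : [set x : R | `|x - b| < r] = ball b r.
    by apply/seteqP; split => x /=; rewrite /ball/= distrC.
  exact: ball_open.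
have oV : open ([set x : R | `|x - b| < r] `\` [set b]).
  by rewrite setDE; apply: openI => //; exact: closed_openC (@closed_eq R b).
(* A late value within [r] of [b] but different from [b] would persist to a nearby rational time,
   which is assumed not to exist. *)
have Ub t : N <= t -> `|f t - b| < r -> f t = b.
  move=> Nt ft; apply: contrapT => ftb; apply: H.
  have [||q [tq _ [Uq bq]]] := @cadlag_rat _ f _ t (t + 1) cf (le_trans N0 Nt) _ oV.
  - by rewrite ltrDl.
  - by [].
  by exists q; split => //; rewrite (le_trans Nt)// ltW.
have [[u Nu bu] _] := uf b N.
have [t ut] := appr u r r0; move/(Ub t (le_trans Nu ut)) => ftb.
(* The supremum [t0] of [E] is the start of the stretch at [b] that contains [t]. *)
pose E := [set s | u <= s <= t /\ f s <> b].
have Eu : E u by rewrite /E/= lexx ut; split => // e; rewrite e ltxx in bu.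
have hE : has_sup E by split; [exists u|exists t => s [/andP[]]].
pose t0 := sup E.
have ut0 : u <= t0 by apply: ub_le_sup => //; exact: hE.2.
have t0t : t0 <= t by apply: ge_sup; [exists u|move=> s [/andP[]]].
have t00 : 0 <= t0 by rewrite (le_trans _ ut0)// (le_trans N0).
have ft0 : f t0 = b.
  apply: contrapT => nb; have ltt : t0 < t.
    by rewrite lt_neqAle t0t andbT; apply/eqP => e; rewrite e in nb.
  have [e e0 eB] := cadlag_right cf t00 (closed_openC (@closed_eq R b)) nb.
  have [p] : exists p : rat, ratr p \in `]t0, (Num.min t (t0 + e))[.
    by apply: rat_in_itvoo; rewrite lt_min ltt ltrDl.
  rewrite in_itv/= lt_min => /andP[tp /andP[pt pe]].
  have : ratr p <= t0.
    apply: ub_le_sup; first exact: hE.2.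
    split; last by apply: eB => //; exact: ltW.
    by rewrite (le_trans ut0 (ltW tp)) ltW.
  by rewrite leNgt tp.
have ltut0 : u < t0.
  by rewrite lt_neqAle ut0 andbT; apply/eqP => e; rewrite e ft0 ltxx in bu.
have t0gt0 : 0 < t0 by rewrite (le_lt_trans _ ltut0)// (le_trans N0).
(* To the right of [t0] the path stays within [r] of [b], hence at [b]; this supplies the rational
   time [q'] required by [touches], as [t0] may be irrational. *)
have [e' e'0 e'B] : exists2 e, 0 < e & forall s, t0 <= s -> s < t0 + e -> `|f s - b| < r.
  by apply: (cadlag_right cf t00 oU); rewrite /= ft0 subrr normr0.
have [q' ] : exists p : rat, ratr p \in `]t0, (t0 + e')[.
  by apply: rat_in_itvoo; rewrite ltrDl.
rewrite in_itv/= => /andP[t0q q'e].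
have [l _ lB] := cadlag_left cf t0gt0.
(* A left limit in [A] puts the path in [A] just before [t0]; restarted there, it touches [b] from
   [A]. *)
have touch A : open A -> A l ->
    (forall q : rat, 0 <= ratr q :> R -> ~ touches (shift (ratr q) f) A b) -> False.
  move=> oA Al nA; have [e e0 eA] := lB A oA Al.
  have [q] : exists p : rat, ratr p \in `](Num.max u (t0 - e)), t0[.
    by apply: rat_in_itvoo; rewrite gt_max ltut0 ltrBlDr ltrDl.
  rewrite in_itv/= gt_max => /andP[/andP[uq eq] qt].
  have q0 : 0 <= ratr q :> R by rewrite (le_trans _ (ltW uq))// (le_trans N0).
  apply: (nA q q0); split; first by rewrite /shift addr0; exact: eA.
  have fafter (s : R) : t0 <= s -> s <= ratr q' -> f s = b.
    move=> ts sq; apply: Ub; first by rewrite (le_trans Nu)// (le_trans ut0).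
    by apply: e'B => //; exact: le_lt_trans q'e.
  exists (q' - q); rewrite rmorphB /=; split.
  - by rewrite subr_ge0 ltW// (lt_trans qt).
  - by rewrite /shift addrC subrK fafter// ltW.
  - move=> s s0; rewrite lerBrDl /shift => sq'.
    have [lt_t0|ge_t0] := ltP (ratr q + ratr s) t0; last by right; exact: fafter.
    by left; apply: eA => //; rewrite (lt_le_trans eq)// lerDl.
have [lb|bl|lb] := ltgtP l b.
- by apply: (touch _ (@open_below _ b)) => //=; rewrite in_itv.
- by apply: (touch _ (@open_above _ b)) => //=; rewrite in_itv/= bl.
(* With left limit [b], the values just before [t0] are within [r] of [b], hence equal to [b],
   contradicting the choice of [t0] as a supremum of times off [b]. *)
have [|e e0 eU] := lB _ oU; first by rewrite /= lb subrr normr0.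
have : 0 < Num.min e (t0 - u) by rewrite lt_min e0 subr_gt0.
move=> /sup_adherent/(_ hE)[s [/andP[us st] fs]] es.
have st0 : s < t0.
  rewrite lt_neqAle (ub_le_sup hE.2) ?andbT; last by split => //; rewrite us.
  by apply/eqP => e1; rewrite e1 in fs.
apply: fs; apply: Ub; first exact: le_trans us.
apply: eU => //; apply: le_lt_trans es.
by rewrite lerD2l lerN2 ge_min lexx.
Qed.

End CrossingPaths.

(** * Measurable conditions on cadlag paths *)

Section PathEvents.
Context (R : realType).
Implicit Types (f : R -> R) (A B : set R) (C D : set (R -> R)) (I J : set R).

Definition coordinate_sets I : set (set (R -> R)) :=
  [set C | exists t B, [/\ 0 <= t, I t, measurable B & C = [set f | B (f t)]] ].

(* Modulo the non-cadlag paths, C only depends, in a measurable way, on the path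
   at the times in I. *)
Definition event I C : Prop := exists2 C', <<s coordinate_sets I>> C' &
  forall f, cadlag f -> C f <-> C' f.

Lemma event_ext I C D : (forall f, cadlag f -> C f <-> D f) -> event I C -> event I D.
Proof. by move=> CD [E mE CE]; exists E => // f cf; rewrite -CD// CE. Qed.

Lemma event_not I C : event I C -> event I [set f | ~ C f].
Proof.
move=> [C' mC CC']; have [_ sC _] := smallest_sigma_algebra setT (coordinate_sets I).
exists (setT `\` C'); first exact: sC.
by move=> f cf; split=> [nC|[_ nC']]; [split => // /(CC' f cf)|move/(CC' f cf)].
Qed.

Lemma event_exists I (T : countType) (F : T -> set (R -> R)) :
  (forall x, event I (F x)) -> event I [set f | exists x, F x f].
Proof.
move=> eF; have [s0 _ sU] := smallest_sigma_algebra setT (coordinate_sets I).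
have /choice[G HG] : forall x, exists C', <<s coordinate_sets I>> C' /\
    forall f, cadlag f -> F x f <-> C' f.
  by move=> x; have [C' ? ?] := eF x; exists C'.
exists (\bigcup_n if unpickle n is Some x then G x else set0).
  by apply: sU => n; case: (unpickle n) => [x|//]; exact: (HG x).1.
move=> f cf; split => [[x /((HG x).2 f cf) Gx]|[n _]].
  by exists (pickle x) => //; rewrite pickleK.
by case: (unpickle n) => [x|//] /((HG x).2 f cf); exists x.
Qed.

Lemma event_forall I (T : countType) (F : T -> set (R -> R)) :
  (forall x, event I (F x)) -> event I [set f | forall x, F x f].
Proof.
move=> eF; apply: (@event_ext I [set f | ~ exists x, ~ F x f]).
  by move=> f _ /=; split => [/forallNP H x|H [x]]; [exact: contrapT|exact].
apply: event_not; apply: event_exists => x; exact: event_not.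
Qed.

Lemma event_const I (Q : Prop) : event I [set _ | Q].
Proof.
have [s0 sC _] := smallest_sigma_algebra setT (coordinate_sets I).
have [q|nq] := pselect Q; last by exists set0.
by exists (setT `\` set0); [exact: sC|move=> f _; split => // _; split].
Qed.

Lemma event_or I C D : event I C -> event I D -> event I [set f | C f \/ D f].
Proof.
move=> eC eD; apply: (@event_ext I [set f | exists x : bool, (if x then C else D) f]).
  move=> f _; split => [[[]]|[]]; [by left|by right|by exists true|by exists false].
by apply: event_exists => -[].
Qed.

Lemma event_and I C D : event I C -> event I D -> event I [set f | C f /\ D f].
Proof.
move=> eC eD; apply: (@event_ext I [set f | forall x : bool, (if x then C else D) f]).
  by move=> f _; split => [H|[? ?] []//]; split; [exact: (H true)|exact: (H false)].
by apply: event_forall => -[].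
Qed.

Lemma event_imply I C D : event I C -> event I D -> event I [set f | C f -> D f].
Proof.
move=> eC eD; apply: (@event_ext I [set f | ~ C f \/ D f]).
  by move=> f _ /=; rewrite implyE.
by apply: event_or => //; exact: event_not.
Qed.

Lemma event_exists_seq I (T : eqType) (s : seq T) (F : T -> set (R -> R)) :
  (forall x, x \in s -> event I (F x)) -> event I [set f | exists2 x, x \in s & F x f].
Proof.
elim: s => [|x s IH] eF.
  by apply: event_ext (event_const _ False) => f _; split => // -[].
apply: (@event_ext I [set f | F x f \/ exists2 y, y \in s & F y f]).
  move=> f _ /=; split => [[Fx|[y ys Fy]]|[y]].
  - by exists x => //; rewrite mem_head.
  - by exists y => //; rewrite in_cons ys orbT.
  - by rewrite in_cons => /orP[/eqP ->|ys Fy]; [left|right; exists y].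
apply: event_or; first by apply: eF; rewrite mem_head.
by apply: IH => y ys; apply: eF; rewrite in_cons ys orbT.
Qed.

Lemma event_coordinate I (t : R) B : 0 <= t -> I t -> measurable B ->
  event I [set f | B (f t)].
Proof.
move=> t0 It mB; exists [set f | B (f t)] => //.
by apply: sub_sigma_algebra; exists t, B.
Qed.

Lemma event_lt I (t c : R) : 0 <= t -> I t -> event I [set f | f t < c].
Proof.
move=> t0 It; have := event_coordinate t0 It (measurable_itv `]-oo, c[).
by apply: event_ext => f _; rewrite /= in_itv.
Qed.

Lemma event_gt I (t c : R) : 0 <= t -> I t -> event I [set f | c < f t].
Proof.
move=> t0 It; have := event_coordinate t0 It (measurable_itv `]c, +oo[).
by apply: event_ext => f _; rewrite /= in_itv/= andbT.
Qed.

Lemma event_sub I J C : I `<=` J -> event I C -> event J C.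
Proof.
move=> IJ [C' mC CC']; exists C' => //; move: C' mC {CC'}.
apply: sub_sigma_algebra2 => _ [t [B [t0 It mB ->]]].
by exists t, B; split => //; exact: IJ.
Qed.

(** The sets with measurable preimage under the shift form a sigma-algebra, and it contains the
    coordinate sets. *)
Lemma event_shift I J (q : R) C : 0 <= q -> (forall t, I t -> J (q + t)) ->
  event I C -> event J [set f | C (shift q f)].
Proof.
move=> q0 IJ [C' mC CC']; exists [set f | C' (shift q f)]; last first.
  by move=> f cf; apply: CC'; exact: cadlag_shift.
suff : <<s coordinate_sets I>> `<=`
    [set E | <<s coordinate_sets J>> [set f | E (shift q f)]] by exact.
have [s0 sC sU] := smallest_sigma_algebra setT (coordinate_sets J).
apply: smallest_sub; first split => //.
- by move=> E /= /sC; congr smallest; apply/seteqP; split => f [].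
- move=> E /= /sU; congr smallest; apply/seteqP; split => f [n _ ?]; exists n => //.
- move=> _ [t [B [t0 It mB ->]]]; apply: sub_sigma_algebra.
  by exists (q + t), B; split => //; [exact: addr_ge0|exact: IJ].
Qed.

End PathEvents.

(** * The Markov property at deterministic times *)

Section ProcessD.
Context (d : measure_display) (Omega : measurableType d) (R : realType).
Context (P : R -> probability Omega R) (F : R -> set (set Omega)).
Context (X : R -> Omega -> R).
Hypothesis HX : strong_markov_process P F X.
Implicit Types (C D : set (R -> R)) (V : set R) (x y q : R).

Lemma event_preimage (I : set R) (G : set (set Omega)) C : sigma_algebra setT G ->
  (forall t B, 0 <= t -> I t -> measurable B -> G (X t @^-1` B)) -> event I C ->
  G [set w | C (X^~ w)].
Proof.
move=> [s0 sC sU] GX [C' mC CC'].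
have -> : [set w | C (X^~ w)] = [set w | C' (X^~ w)].
  by apply/seteqP; split => w /(CC' _ (process_cadlag HX w)).
suff : <<s coordinate_sets I>> `<=` [set E | G [set w | E (X^~ w)]] by exact.
apply: smallest_sub; first split => //.
- by move=> E /= /sC; congr G; apply/seteqP; split => f [].
- by move=> E /= /sU; congr G; apply/seteqP; split => f [n _ ?]; exists n.
- by move=> _ [t [B [t0 It mB ->]]]; exact: GX.
Qed.

Lemma event_adapted (t : R) C : 0 <= t -> event [set s | s <= t] C -> F t [set w | C (X^~ w)].
Proof.
move=> t0; have [sF _ Fnd] := process_filtration HX.
apply: event_preimage; first exact: sF.
by move=> s B s0 st mB; apply: (Fnd s t) => //; exact: (process_adapted HX).
Qed.

Lemma measurable_coordinate (t : R) B : 0 <= t -> measurable B -> measurable (X t @^-1` B).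
Proof.
move=> t0 mB; have [_ Fm _] := process_filtration HX.
by apply: (Fm t) => //; exact: (process_adapted HX).
Qed.

Lemma measurable_event C : event setT C -> measurable [set w | C (X^~ w)].
Proof.
apply: event_preimage; first exact: sigma_algebra_measurable.
by move=> t B t0 _; exact: measurable_coordinate.
Qed.

Lemma measurable_event_shift q C : 0 <= q -> event setT C ->
  measurable [set w | C (shift q (X^~ w))].
Proof.
by move=> q0 eC; apply: (@measurable_event [set f | C (shift q f)]); exact: event_shift eC.
Qed.

(** The strong Markov property at the constant stopping time [q], after replacing [C] by a
    measurable set of paths that agrees with it on cadlag paths. *)
Lemma markov x q A C : 0 <= q -> F q A -> event setT C ->
  (P x (A `&` [set w | C (shift q (X^~ w))]) = \int[P x]_(w in A) path_law P X C (X q w))%E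
  /\ measurable_fun setT (fun w => path_law P X C (X q w)).
Proof.
move=> q0 FA [C' mC CC'].
have cC w : C (X^~ w) <-> C' (X^~ w) by exact: CC' (process_cadlag HX w).
have pC' : path_measurable C'.
  move: C' mC {CC' cC}; apply: sub_sigma_algebra2 => _ [t [B [t0 _ mB ->]]].
  by exists t, B.
have -> : path_law P X C = path_law P X C'.
  apply/funext => y; rewrite /path_law; congr (P y _).
  by apply/seteqP; split => w /cC.
split; last first.
  apply: (measurableT_comp (process_kernel HX pC')) => _ B mB; rewrite setTI.
  exact: measurable_coordinate.
have [sF Fm Fnd] := process_filtration HX.
have := process_strong_markov HX x (S := fun=> q%:E) (A := A) _ _ pC'.
have -> : [set _ : Omega | (q%:E < +oo)%E] = setT.
  by apply/seteqP; split => w //= _; exact: ltry.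
rewrite setIT => <- //.
- congr (P x _); apply/seteqP; split => w [Aw].
    move=> /(CC' _ (cadlag_shift q0 (process_cadlag HX w))); split => //.
    by split => //; exact: ltry.
  by move=> [_ H]; split => //; apply/(CC' _ (cadlag_shift q0 (process_cadlag HX w))).
- split => // t t0; have [s0 sC _] := sF t t0; rewrite lee_fin.
  have [qt|tq] := leP q t; last by rewrite (_ : [set _ | _] = set0)//; apply/seteqP; split.
  by rewrite (_ : [set _ | _] = setT `\` set0); [exact: sC|rewrite setD0; apply/seteqP; split].
- split; first exact: (Fm q).
  move=> t t0; have [s0 sC _] := sF t t0.
  have [qt|tq] := leP q t.
    rewrite (_ : _ `&` _ = A); first exact: (Fnd q t).
    by apply/seteqP; split => w; [case|move=> ?; split => //=; rewrite lee_fin].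
  rewrite (_ : _ `&` _ = set0)//; apply/seteqP; split => // w [_ /=].
  by rewrite lee_fin leNgt tq.
Qed.

Lemma markov_ge x q A C V (a : R) : 0 <= q -> 0 <= a -> F q A -> event setT C ->
  (forall w, A w -> V (X q w)) -> (forall y, V y -> (a%:E <= P y [set w | C (X^~ w)])%E) ->
  (a%:E * P x A <= P x (A `&` [set w | C (shift q (X^~ w))]))%E.
Proof.
move=> q0 a0 FA eC AV CV; have [-> mp] := markov x q0 FA eC.
have [_ Fm _] := process_filtration HX.
have mA : measurable A by exact: (Fm q).
rewrite -integral_cst//; apply: ge0_le_integral => //.
- exact: measurable_funTS.
- by move=> w Aw /=; apply: CV; exact: AV.
Qed.

(** For one restart time the Markov property integrates the value 0 over the event of being in [V];
    there are only countably many rational restart times. *)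
Lemma markov_null x C V : measurable V -> event setT C ->
  (forall y, V y -> P y [set w | C (X^~ w)] = 0%E) ->
  {ae P x, forall w, forall q : rat, 0 <= ratr q :> R -> V (X (ratr q) w) ->
     ~ C (shift (ratr q) (X^~ w))}.
Proof.
move=> mV eC CV.
pose N n := if unpickle n is Some q then
  [set w | [/\ 0 <= ratr q :> R, V (X (ratr q) w) & C (shift (ratr q) (X^~ w))]] else set0.
apply: (@negligibleS _ _ _ _ (\bigcup_n N n)).
  move=> w /= /existsNP[q] /not_implyP[q0 /not_implyP[Vq /contrapT Cq]].
  by exists (pickle q); [exact: I|rewrite /N pickleK; exact: And3].
apply: negligible_bigcup => n; rewrite /N.
case: (unpickle n) => [q|]; last exact: negligible_set0.
have [q0|nq0] := pselect (0 <= ratr q :> R); last first.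
  by rewrite (_ : [set _ | _] = set0); [exact: negligible_set0|apply/seteqP; split => w []].
have FA : F (ratr q) (X (ratr q) @^-1` V) by exact: (process_adapted HX).
have [e _] := markov x q0 FA eC.
exists ((X (ratr q) @^-1` V) `&` [set w | C (shift (ratr q) (X^~ w))]); split.
- by apply: measurableI; [exact: measurable_coordinate|exact: measurable_event_shift].
- by rewrite /= e integral0_eq// => w; exact: CV.
- by move=> w [].
Qed.

End ProcessD.

(** * Visits to a set at late rational times *)

Section Visits.
Context (R : realType).
Implicit Types (C : set (R -> R)) (V : set R) (N : R).

Definition visits V N : set (R -> R) :=
  [set f | exists q : rat, N <= ratr q /\ V (f (ratr q))].

Definition visits_then V C N : set (R -> R) :=
  [set f | exists q : rat, [/\ N <= ratr q, V (f (ratr q)) & C (shift (ratr q) f)]].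

Lemma event_visits_then V C N : 0 <= N -> measurable V -> event setT C ->
  event setT (visits_then V C N).
Proof.
move=> N0 mV eC; apply: event_exists => q.
have [Nq|nNq] := pselect (N <= ratr q); last first.
  by apply: event_ext (event_const _ False) => f _; split => // -[].
have q0 := le_trans N0 Nq.
apply: (@event_ext _ _ [set f | V (f (ratr q)) /\ C (shift (ratr q) f)]).
  by move=> f _; split => [[]|[]].
apply: event_and; first exact: event_coordinate.
exact: event_shift eC.
Qed.

Lemma visitsE V N : visits V N = visits_then V setT N.
Proof. by apply/seteqP; split => f [q []]; exists q. Qed.

Lemma event_visits V N : 0 <= N -> measurable V -> event setT (visits V N).
Proof.
by move=> N0 mV; rewrite visitsE; apply: event_visits_then => //; exact: (event_const _ True).
Qed.

End Visits.

(** * Conditioning at the first of finitely many visits, and passage to the limit *)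

Section ProcessE.
Context (d : measure_display) (Omega : measurableType d) (R : realType).
Context (P : R -> probability Omega R) (F : R -> set (set Omega)).
Context (X : R -> Omega -> R).
Hypothesis HX : strong_markov_process P F X.
Implicit Types (C D : set (R -> R)) (V : set R) (x y q N : R).

Let on C := [set w | C (X^~ w)].
Let mon C : event setT C -> measurable (on C).
Proof. exact: (measurable_event HX). Qed.

(** Induction on the increasing list of times amounts to conditioning at the first visit to [V]. The
    event [A], known at every time of the list, accumulates the information that no visit has
    occurred yet. *)
Lemma markov_first_visit x A C V (a : R) (s : seq R) : measurable V -> 0 <= a ->
  event setT C -> (forall y, V y -> (a%:E <= P y (on C))%E) ->
  all (>= 0) s -> sorted <=%R s -> (forall q, q \in s -> F q A) -> measurable A ->
  (a%:E * P x (A `&` on [set f | exists2 q, q \in s & V (f q)]) <=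
   P x (A `&` on [set f | exists2 q, q \in s & V (f q) /\ C (shift q f)]))%E.
Proof.
move=> mV a0 eC CV; elim: s A => [|q s IH] A s0 ss FA mA.
  have -> : on [set f | exists2 q, q \in [::] & V (f q)] = set0.
    by apply/seteqP; split => w // [].
  by rewrite setI0 measure0 mule0.
move: s0 => /= /andP[q0 s0].
have qs r : r \in s -> q <= r.
  by move=> rs; move/(order_path_min le_trans)/allP : ss => /(_ r rs).
have [sF Fm Fnd] := process_filtration HX.
have e1 : event setT [set f | exists2 q, q \in s & V (f q)].
  by apply: event_exists_seq => r rs; apply: event_coordinate => //; exact: (allP s0).
have e2 : event setT [set f | exists2 q, q \in s & V (f q) /\ C (shift q f)].
  apply: event_exists_seq => r rs; apply: event_and.
    by apply: event_coordinate => //; exact: (allP s0).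
  by apply: event_shift eC => //; exact: (allP s0).
pose B := X q @^-1` V.
have mB : measurable B by exact: (measurable_coordinate HX).
have mqC := measurable_event_shift HX q0 eC.
have FqA : F q A by apply: FA; rewrite mem_head.
have FqB : F q B by exact: (process_adapted HX).
have FI t G H : 0 <= t -> F t G -> F t H -> F t (G `&` H).
  move=> t0 FG FH; have := sigma_algebra_id (sF t t0) => <-.
  have := @measurableI _ (g_sigma_algebraType (F t)) G H.
  by apply; rewrite /measurable/= sigma_algebra_id//; exact: sF.
have FC t G : 0 <= t -> F t G -> F t (~` G).
  by move=> t0 FG; have [_ sC _] := sF t t0; rewrite -setTD; exact: sC.
(* Either [V] is visited at the earliest time [q], and the Markov property applies there, or the
   absence of a visit at [q] is added to [A]. *)
have -> : A `&` on [set f | exists2 q0, q0 \in q :: s & V (f q0)] =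
    (A `&` B) `|` ((A `&` ~` B) `&` on [set f | exists2 q, q \in s & V (f q)]).
  apply/seteqP; split => [w [Aw [r]]|w [[Aw Bw]|[[Aw nB] [r rs Vr]]]].
  - have [Bw|nBw] := pselect (B w); first by left.
    rewrite in_cons => /orP[/eqP -> //|rs Vr]; right; split => //.
    by exists r.
  - by split => //; exists q => //; rewrite mem_head.
  - by split => //; exists r => //; rewrite in_cons rs orbT.
rewrite measureU; [|exact: measurableI| |]; last 2 first.
- by apply: measurableI; [apply: measurableI => //; exact: measurableC|exact: mon].
- by apply/seteqP; split => // w [[_ Bw] [[_]]].
rewrite ge0_muleDr//.
apply: (@le_trans _ _ (P x ((A `&` B) `&` [set w | C (shift q (X^~ w))]) +
    P x ((A `&` ~` B) `&` on [set f | exists2 q, q \in s & V (f q) /\ C (shift q f)]))%E).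
  apply: leeD.
    by apply: (@markov_ge _ _ _ _ _ _ HX x q (A `&` B) C V a) => //; [exact: FI|move=> w []].
  apply: IH => //; first exact: path_sorted ss.
  - move=> r rs; have r0 := le_trans q0 (qs r rs).
    apply: FI => //; first by apply: FA; rewrite in_cons rs orbT.
    by apply: FC => //; apply: (Fnd q r q0 (qs r rs)).
  - by apply: measurableI => //; exact: measurableC.
rewrite -measureU; [|apply: measurableI => //; exact: measurableI| |]; last 2 first.
- by apply: measurableI; [apply: measurableI => //; exact: measurableC|exact: mon].
- by apply/seteqP; split => // w [[[_ Bw] _] [[_]]].
apply: le_measure.
- rewrite inE; apply: measurableU; first by apply: measurableI => //; exact: measurableI.
  by apply: measurableI; [apply: measurableI => //; exact: measurableC|exact: mon].
- rewrite inE; apply: measurableI => //; apply: mon.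
  apply: event_exists_seq => r; rewrite in_cons => /orP rs.
  have r0 : 0 <= r by case: rs => [/eqP -> //|rs]; exact: (allP s0).
  by apply: event_and; [exact: event_coordinate|exact: event_shift eC].
- move=> w [[[Aw Bw] Cw]|[[Aw _] [r rs [Vr Cr]]]]; split => //.
  + by exists q => //; rewrite mem_head.
  + by exists r => //; rewrite in_cons rs orbT.
Qed.

(** The rationals from [N] on are exhausted by finite sorted lists; the bound passes to the limit by
    continuity from below. *)
Lemma markov_visits x C V (a : R) N : measurable V -> 0 <= a -> 0 <= N ->
  event setT C -> (forall y, V y -> (a%:E <= P y (on C))%E) ->
  (a%:E * P x (on (visits V N)) <= P x (on (visits_then V C N)))%E.
Proof.
move=> mV a0 N0 eC CV.
(* The rationals with code below [n] that are at least [N], in increasing order. *)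
pose s n := sort <=%R [seq r <- [seq ratr q | q : rat <- pmap unpickle (iota 0 n)] | N <= r].
have sN n r : r \in s n -> N <= r by rewrite mem_sort mem_filter => /andP[].
have s_rat n r : r \in s n -> exists q : rat, r = ratr q.
  by rewrite mem_sort mem_filter => /andP[_ /mapP[q _ ->]]; exists q.
pose Vn n := on [set f | exists2 q, q \in s n & V (f q)].
have mVn n : measurable (Vn n).
  apply: mon; apply: event_exists_seq => r /sN Nr.
  by apply: event_coordinate => //; exact: le_trans Nr.
have UV : \bigcup_n Vn n = on (visits V N).
  apply/seteqP; split => [w [n _ [r rs Vr]]|w [q [Nq Vq]]].
    have [q e] := s_rat _ _ rs; exists q; rewrite -e; split => //; exact: sN rs.
  exists (pickle q).+1 => //; exists (ratr q) => //.
  rewrite mem_sort mem_filter Nq map_f// mem_pmap; apply/mapP; exists (pickle q).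
    by rewrite mem_iota/=.
  by rewrite pickleK.
have : P x \o Vn @ \oo --> P x (on (visits V N)).
  rewrite -UV; apply: nondecreasing_cvg_mu => //; first exact: bigcup_measurable.
  move=> m n mn; rewrite subsetEset => w [r rs Vr]; exists r => //.
  move: rs; rewrite !mem_sort !mem_filter => /andP[-> /= /mapP[q qm ->]].
  apply: map_f; move: qm; rewrite !mem_pmap => /mapP[k]; rewrite mem_iota => /= km ->.
  by apply: map_f; rewrite mem_iota/= (leq_trans km).
move=> /(cvgeZl (y := a%:E) isT) cv; rewrite -(cvg_lim _ cv)//.
apply: lime_le; first by apply/cvg_ex; eexists; exact: cv.
apply: nearW => n /=.
have := @markov_first_visit x setT C V a (s n) mV a0 eC CV.
rewrite !setTI => /(_ _ _ _ measurableT)/le_trans; apply.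
- by apply/allP => r /sN; exact: le_trans.
- exact/sort_sorted/le_total.
- move=> r /sN Nr; have [sF _ _] := process_filtration HX.
  have [s0 sC _] := sF r (le_trans N0 Nr).
  by rewrite -(setD0 setT); exact: sC.
apply: le_measure; rewrite ?inE.
- apply: mon; apply: event_exists_seq => r /sN Nr; have r0 := le_trans N0 Nr.
  by apply: event_and; [exact: event_coordinate|exact: event_shift eC].
- by apply: mon; exact: event_visits_then.
- move=> w [r rs [Vr Cr]]; have [q e] := s_rat _ _ rs.
  by exists q; rewrite -e; split => //; exact: sN rs.
Qed.

(** Visits at arbitrarily late times are visits after each [n], and the events on the right decrease
    in [n], so continuity from above applies. *)
Lemma markov_visits_infinitely_often x C V (a : R) : measurable V -> 0 <= a ->
  event setT C -> (forall y, V y -> (a%:E <= P y (on C))%E) ->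
  (a%:E * P x (on [set f | forall n : nat, visits V n%:R f]) <=
   P x (on [set f | forall n : nat, visits_then V C n%:R f]))%E.
Proof.
move=> mV a0 eC CV.
have eK n : event setT (visits_then V C n%:R) by exact: event_visits_then.
have KE : \bigcap_n on (visits_then V C n%:R) =
    on [set f | forall n : nat, visits_then V C n%:R f].
  by apply/seteqP; split => [w H n|w H n _]; exact: H.
have mK : measurable (on [set f | forall n : nat, visits_then V C n%:R f]).
  by apply: mon; exact: event_forall.
have cv : P x \o (fun n : nat => on (visits_then V C n%:R)) @ \oo -->
    P x (on [set f | forall n : nat, visits_then V C n%:R f]).
  rewrite -KE; apply: nonincreasing_cvg_mu; rewrite ?KE//.
  - by apply: (@le_lt_trans _ _ 1%E); [by apply: probability_le1; exact: mon|exact: ltry].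
  - by move=> n; exact: mon.
  - move=> m n mn; rewrite subsetEset => w [q [nq Vq Cq]]; exists q; split => //.
    by rewrite (le_trans _ nq)// ler_nat.
rewrite -(cvg_lim _ cv)//; apply: lime_ge; first by apply/cvg_ex; eexists; exact: cv.
apply: nearW => n /=.
apply: (le_trans _ (@markov_visits x C V a n%:R mV a0 (ler0n _ _) eC CV)).
apply: lee_wpmul2l; first by rewrite lee_fin.
apply: le_measure; rewrite ?inE.
- by apply: mon; apply: event_forall => k; exact: event_visits.
- by apply: mon; exact: event_visits.
- by move=> w; exact.
Qed.

End ProcessE.

(** * Measurability of landing, crossing, touching, creeping and clustering *)

Section Events.
Context (R : realType).
Implicit Types (f : R -> R) (A B : set R) (C D : set (R -> R)) (I J : set R).
Implicit Types (b c t M : R).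

Lemma shift_shift f (p q : R) : shift q (shift p f) = shift (p + q) f.
Proof. by apply/funext => t; rewrite /shift addrA. Qed.

Lemma open_lt_mul (e c : R) : open [set x | c < e * x].
Proof.
by apply: (open_comp (f := *%R e) (D := [set y | c < y])) => // x _;
  exact: mulrl_continuous.
Qed.

Lemma closed_le_mul (e c : R) : closed [set x | c <= e * x].
Proof.
by apply: (closed_comp (f := *%R e) (D := [set y | c <= y])) => // x _;
  exact: mulrl_continuous.
Qed.

Lemma inv_nat_lt (e : R) : 0 < e -> exists n : nat, n.+1%:R^-1 < e.
Proof.
move=> e0; exists (Num.bound e^-1); rewrite invf_plt ?posrE//.
apply: lt_trans (archi_boundP _) _; first by rewrite invr_ge0 ltW.
by rewrite ltr_nat.
Qed.

Section Landing.
Context (T : (R -> R) -> \bar R).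
Hypothesis T_ge0 : forall f, (0 <= T f)%E.
Hypothesis event_T : forall t, 0 < t -> event setT [set f | (T f < t%:E)%E].

Let event_Tlt t : event setT [set f | (T f < t%:E)%E].
Proof.
have [/event_T//|t0] := ltP 0 t.
apply: event_ext (event_const _ False) => f _; split => //=.
by move/(le_lt_trans (T_ge0 f)); rewrite lte_fin ltNge t0.
Qed.

Lemma event_finite : event setT [set f | (T f < +oo)%E].
Proof.
apply: (@event_ext _ _ [set f | exists n : nat, (T f < n%:R%:E)%E]); last first.
  by apply: event_exists => n; exact: event_Tlt.
move=> f _ /=; split => [[n /lt_trans]|]; first by apply; exact: ltry.
move=> fin; have Te : (fine (T f))%:E = T f by rewrite fineK// ge0_fin_numE.
by exists (Num.bound (fine (T f))); rewrite -Te lte_fin archi_boundP// fine_ge0.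
Qed.

(** By right-continuity, a value above [c] at time [T f] means that for some margins 1/(k+1) and
    1/(n+1) the values at all rational times in ]T f, T f + 1/(n+1)] are at least c + 1/(k+1). The
    factor [e] is 1 or -1 in the applications and covers both rays. *)
Lemma event_lands_ray (e c : R) :
  event setT [set f | path_lands f (T f) [set x | c < e * x]].
Proof.
apply: (@event_ext _ _ [set f | (T f < +oo)%E /\ exists k n : nat, forall s : rat,
    0 <= ratr s :> R -> (T f < (ratr s)%:E)%E /\
    ~ (T f < (ratr s - n.+1%:R^-1)%:E)%E -> ~ e * f (ratr s) < c + k.+1%:R^-1]); last first.
  apply: event_and; first exact: event_finite.
  apply: event_exists => k; apply: event_exists => n; apply: event_forall => s.
  have [s0|ns0] := pselect (0 <= ratr s :> R); last first.
    by apply: event_ext (event_const _ True) => f _; split.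
  apply: (@event_ext _ _ [set f | (T f < (ratr s)%:E)%E /\
      ~ (T f < (ratr s - n.+1%:R^-1)%:E)%E -> ~ e * f (ratr s) < c + k.+1%:R^-1]).
    by move=> f _; split => [H _|]; [exact: H|exact].
  apply: event_imply.
    by apply: event_and; [exact: event_Tlt|apply: event_not; exact: event_Tlt].
  apply: event_not.
  apply: (@event_coordinate _ _ (ratr s) [set x | e * x < c + k.+1%:R^-1]) => //.
  apply: open_measurable.
  rewrite (_ : [set _ | _] = [set x | - (c + k.+1%:R^-1) < (- e) * x]).
    exact: open_lt_mul.
  by apply/seteqP; split => x /=; rewrite mulNr ltrN2.
move=> f cf; split=> [[fin [k [n H]]]|[fin cT]]; split => //.
  have Te : (fine (T f))%:E = T f by rewrite fineK// ge0_fin_numE.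
  have t0 : 0 <= fine (T f) by exact: fine_ge0.
  (* The margin 1/(k+1) turns the strict inequality into a closed condition, which passes to the
     limit from the right. *)
  suff : [set x | c + k.+1%:R^-1 <= e * x] (f (fine (T f))).
    by move=> /=; apply: lt_le_trans; rewrite ltrDl invr_gt0.
  apply: (cadlag_closed cf t0 (@closed_le_mul e _)) => d d0.
  have : fine (T f) < fine (T f) + Num.min d n.+1%:R^-1 by rewrite ltrDl lt_min d0 invr_gt0/=.
  move=> /rat_in_itvoo[s]; rewrite in_itv/= -ltrBlDl lt_min => /andP[Ts /andP[sd sn]].
  exists (ratr s); split; [exact: ltW|by rewrite -ltrBlDl|].
  rewrite /= leNgt; apply/negP; apply: H; first by rewrite (le_trans t0)// ltW.
  split; first by rewrite -Te lte_fin.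
  by rewrite -Te lte_fin; apply/negP; rewrite -leNgt lerBlDl -lerBlDr ltW// .
have Te : (fine (T f))%:E = T f by rewrite fineK// ge0_fin_numE.
have t0 : 0 <= fine (T f) by exact: fine_ge0.
have [k kc] : exists k : nat, k.+1%:R^-1 < e * f (fine (T f)) - c.
  by apply: inv_nat_lt; rewrite subr_gt0.
have [d d0 dB] := cadlag_right cf t0 (@open_lt_mul e (c + k.+1%:R^-1))
  (etrans (esym (ltrBrDl _ _ _)) kc).
have [n nd] := inv_nat_lt d0; exists k, n => s s0; rewrite -Te !lte_fin => -[Ts].
move=> /negP; rewrite -leNgt lerBlDr => sn; apply/negP; rewrite -leNgt ltW//.
by apply: dB; [exact: ltW|rewrite (le_lt_trans sn)// ltrD2l].
Qed.

Lemma event_lands_above c : event setT [set f | path_lands f (T f) `]c, +oo[].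
Proof.
by have := event_lands_ray 1 c; apply: event_ext => f _;
  rewrite /path_lands/= mul1r in_itv/= andbT.
Qed.

Lemma event_lands_below c : event setT [set f | path_lands f (T f) `]-oo, c[].
Proof.
have := event_lands_ray (-1) (- c).
by apply: event_ext => f _; rewrite /path_lands/= mulN1r ltrN2 in_itv/=.
Qed.

Lemma event_lands_set1 c : event setT [set f | path_lands f (T f) [set c]].
Proof.
apply: (@event_ext _ _ [set f | (T f < +oo)%E /\
    ~ (path_lands f (T f) `]c, +oo[ \/ path_lands f (T f) `]-oo, c[)]).
  move=> f _; split => [[fin H]|[fin fc]]; split => //.
    rewrite /=; have [lt|gt|//] := ltgtP (f (fine (T f))) c; exfalso; apply: H.
      by right; split => //=; rewrite in_itv.
    by left; split => //=; rewrite in_itv/= andbT.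
  by move: fc => /= fc; move=> [|] [_] /=; rewrite fc in_itv/= ltxx.
apply: event_and; first exact: event_finite.
apply: event_not; apply: event_or; [exact: event_lands_above|exact: event_lands_below].
Qed.

End Landing.

Lemma event_crossed b k t I : [set s | 0 < s < t] `<=` I -> event I [set f | crossed f b k t].
Proof.
elim: k t I => [|k IH] t I tI; first exact: (event_const _ True).
apply: event_exists => p; apply: event_exists => q.
have [[p0 pq qt]|n] := pselect [/\ 0 < ratr p :> R, ratr p < ratr q :> R & ratr q < t]; last first.
  by apply: event_ext (event_const _ False) => f _; split => // -[].
have q0 := lt_trans p0 pq; have pt := lt_trans pq qt.
apply: (@event_ext _ _ [set f | crossed f b k (ratr p) /\ (f (ratr p) < b /\ b < f (ratr q))]).
  by move=> f _; split => [[? []]|[_ []]].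
apply: event_and.
  apply: IH => s /= /andP[s0 sp]; apply: tI => /=; rewrite s0/=; exact: lt_trans pt.
by apply: event_and; [apply: event_lt|apply: event_gt]; rewrite ?ltW//; apply: tI; apply/andP.
Qed.

Lemma event_clusters_by b M : event [set s | s <= M] [set f | clusters_by f b M].
Proof.
have e t k : t <= M -> event [set s | s <= M] [set f | crossed f b k t].
  by move=> tM; apply: event_crossed => s /= /andP[_ /ltW st]; exact: le_trans tM.
apply: event_forall => k; apply: event_and; first exact: e.
apply: event_exists => t.
have [[t0 tM]|n] := pselect (0 < ratr t :> R /\ ratr t <= M); last first.
  by apply: event_ext (event_const _ False) => f _; split => // -[? ? _ _]; apply: n.
apply: (@event_ext _ _ [set f | crossed f b k.+1 (ratr t) /\ ~ crossed f b k.+2 (ratr t)]).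
  by move=> f _; split => [[]|[]].
by apply: event_and; [exact: e|apply: event_not; exact: e].
Qed.

Lemma event_lands_up_crossing1_above b c :
  event setT [set f | path_lands f (up_crossing f b 1) `]c, +oo[].
Proof.
apply: (event_lands_above (T := fun f => up_crossing f b 1)).
  by move=> f; exact: up_crossing_ge0.
move=> t t0; apply: (@event_ext _ _ [set f | crossed f b 1 t]); last exact: event_crossed.
by move=> f cf; exact: crossedP.
Qed.

Lemma event_lands_up_crossing1_below b c :
  event setT [set f | path_lands f (up_crossing f b 1) `]-oo, c[].
Proof.
apply: (event_lands_below (T := fun f => up_crossing f b 1)).
  by move=> f; exact: up_crossing_ge0.
move=> t t0; apply: (@event_ext _ _ [set f | crossed f b 1 t]); last exact: event_crossed.
by move=> f cf; exact: crossedP.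
Qed.

Lemma event_debut_lands B b : open B ->
  event setT [set f | path_lands f (debut f B 0) [set b]].
Proof.
move=> oB; apply: (event_lands_set1 (T := fun f => debut f B 0)).
  by move=> f; exact: debut_ge0.
move=> t t0; apply: (@event_ext _ _ [set f | exists q : rat,
    [/\ 0 < ratr q :> R, ratr q < t & B (f (ratr q))]]).
  move=> f cf; split => [[q [q0 qt Bq]]|].
    by apply/(debut_lt_rat _ cf oB (lexx _)); exists q.
  by move=> /(debut_lt_rat _ cf oB (lexx _))[q [q0 _ Bq qt]]; exists q.
apply: event_exists => q.
have [[q0 qt]|n] := pselect (0 < ratr q :> R /\ ratr q < t); last first.
  by apply: event_ext (event_const _ False) => f _; split => // -[? ? _]; apply: n.
apply: (@event_ext _ _ [set f | B (f (ratr q))]); first by move=> f _; split => [|[]].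
by apply: event_coordinate => //; [exact: ltW|exact: open_measurable].
Qed.

Lemma event_touches A b : measurable A -> event setT [set f | touches f A b].
Proof.
move=> mA; apply: event_and; first exact: event_coordinate.
apply: event_exists => q.
have [q0|n] := pselect (0 <= ratr q :> R); last first.
  by apply: event_ext (event_const _ False) => f _; split => // -[].
apply: (@event_ext _ _ [set f | [set b] (f (ratr q)) /\ forall s : rat,
    0 <= ratr s :> R -> ratr s <= ratr q :> R -> (A `|` [set b]) (f (ratr s))]).
  by move=> f _; split => [[]|[]].
apply: event_and; first exact: event_coordinate.
apply: event_forall => s.
have [s0|n] := pselect (0 <= ratr s :> R); last first.
  by apply: event_ext (event_const _ True) => f _; split.
apply: (@event_ext _ _ [set f | ratr s <= ratr q :> R -> (A `|` [set b]) (f (ratr s))]).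
  by move=> f _; split => [H _|]; [|exact].
apply: event_imply; first exact: event_const.
by apply: event_coordinate => //; exact: measurableU.
Qed.

Lemma event_creeps b : event setT [set f | creeps f b].
Proof.
apply: event_or; apply: event_and.
- exact: event_gt.
- exact/event_debut_lands/open_below.
- exact: event_lt.
- exact/event_debut_lands/open_above.
Qed.

(* Crossings counted from time 0 may be stuck at 0, so they are counted from some
   rational time q; this also makes [clusters] inherited from shifted paths. *)
Definition clusters_before f b t : Prop := exists q M : rat,
  [/\ 0 <= ratr q :> R, 0 < ratr M :> R, ratr q + ratr M <= t &
   clusters_by (shift (ratr q) f) b (ratr M)].

Lemma event_clusters_before b t :
  event [set s | s <= t] [set f | clusters_before f b t].
Proof.
apply: event_exists => q; apply: event_exists => M.
have [[q0 M0 qM]|n] := pselect [/\ 0 <= ratr q :> R, 0 < ratr M :> R & ratr q + ratr M <= t];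
  last first.
  by apply: event_ext (event_const _ False) => f _; split => // -[? ? ? _]; apply: n.
apply: (@event_ext _ _ [set f | clusters_by (shift (ratr q) f) b (ratr M)]).
  by move=> f _; split => [|[]].
apply: (@event_shift _ [set s | s <= ratr M] _ _ [set f | clusters_by f b (ratr M)]) => //.
  by move=> s /= sM; apply: le_trans qM; rewrite lerD2l.
exact: event_clusters_by.
Qed.

Definition clusters f b : Prop := exists N : nat, clusters_before f b N%:R.

Lemma event_clusters b : event setT [set f | clusters f b].
Proof.
apply: event_exists => N.
by apply: (@event_sub _ [set s | s <= N%:R]) => //; exact: event_clusters_before.
Qed.

Lemma clusters_shift f b (p : rat) : 0 <= ratr p :> R ->
  clusters (shift (ratr p) f) b -> clusters f b.
Proof.
move=> p0 [N [q [M [q0 M0 qM]]]]; rewrite shift_shift => acc.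
exists (Num.bound (ratr p + ratr q + ratr M : R)), (p + q), M.
rewrite rmorphD; split => //; first exact: addr_ge0.
by apply/ltW/archi_boundP; exact: addr_ge0 (addr_ge0 p0 q0) (ltW M0).
Qed.

Lemma clusters_by_clusters f b (M : rat) : 0 < ratr M :> R ->
  clusters_by f b (ratr M) -> clusters f b.
Proof.
move=> M0 acc; exists (Num.bound (ratr M : R)), 0, M; rewrite rmorph0 add0r; split => //.
  by apply/ltW/archi_boundP/ltW.
by rewrite (_ : shift 0 f = f)//; apply/funext => t; rewrite /shift add0r.
Qed.

Lemma cvg_shift f (q s l : R) : shift q f t @[t --> s^'-] --> l ->
  f t @[t --> (q + s)^'-] --> l.
Proof.
move=> fs; have := @add_at_left R (- q) (q + s); rewrite addKr => H.
suff <- : shift q f \o (fun t => - q + t) = f.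
  exact: cvg_comp H fs.
by apply/funext => t; rewrite /shift/= addNKr.
Qed.

Lemma left_limit_of_clusters f b : cadlag f -> clusters f b ->
  exists2 s, 0 < s & f t @[t --> s^'-] --> b.
Proof.
move=> cf [N [q [M [q0 M0 qM]]]].
move=> /(left_limit_accumulation (cadlag_shift q0 cf) M0)[s s0 /cvg_shift fs].
by exists (ratr q + s); first exact: ltr_wpDl.
Qed.

End Events.

(** * Upper and lower limits expressed through visits *)

Section Limits.
Context (R : realType).
Implicit Types (f : R -> R) (b : R).

Lemma unbounded_of_limsup_liminf f :
  limf_esup (fun t => (f t)%:E) +oo%R = +oo%E ->
  limf_einf (fun t => (f t)%:E) +oo%R = -oo%E -> unbounded_both_sides f.
Proof.
rewrite limf_esupE limf_einfE => fsup finf M T.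
have FT : (+oo%R : set_system R) [set t | (T <= t)%R] by exact: (nbhs_pinfty_ge (num_real _)).
split.
  have : (+oo <= ereal_sup ((fun t => (f t)%:E) @` [set t | (T <= t)%R]))%E.
    by rewrite -fsup; apply: ereal_inf_lbound; exists [set t | (T <= t)%R].
  rewrite leye_eq => /eqP e.
  have /ereal_sup_gt[_ [t Tt <-]] :
      (M%:E < ereal_sup ((fun t => (f t)%:E) @` [set t | (T <= t)%R]))%E.
    by rewrite e ltry.
  by rewrite lte_fin; exists t.
have : (ereal_inf ((fun t => (f t)%:E) @` [set t | (T <= t)%R]) <= -oo)%E.
  by rewrite -finf; apply: ereal_sup_ubound; exists [set t | (T <= t)%R].
rewrite leeNy_eq => /eqP e.
have /ereal_inf_lt[_ [t Tt <-]] :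
    (ereal_inf ((fun t => (f t)%:E) @` [set t | (T <= t)%R]) < M%:E)%E.
  by rewrite e ltNyr.
by rewrite lte_fin; exists t.
Qed.

Definition approaches_path f b : Prop :=
  forall N e : R, 0 < e -> exists2 t, N <= t & `|f t - b| < e.

Lemma liminf_dist0 f b : limf_einf (fun t => `|f t - b|%R%:E) +oo%R = 0%E <->
  approaches_path f b.
Proof.
rewrite limf_einfE; split => [H N e e0|H].
  have FN : (+oo%R : set_system R) [set t | (N <= t)%R] by exact: (nbhs_pinfty_ge (num_real _)).
  have : (ereal_inf ((fun t => `|f t - b|%R%:E) @` [set t | (N <= t)%R]) <= 0)%E.
    by rewrite -H; apply: ereal_sup_ubound; exists [set t | (N <= t)%R].
  move=> h; have : (ereal_inf ((fun t => `|f t - b|%R%:E) @` [set t | (N <= t)%R]) < e%:E)%E.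
    by apply: le_lt_trans h _; rewrite lte_fin.
  by move=> /ereal_inf_lt[_ [t Nt <-]]; rewrite lte_fin; exists t.
apply/eqP; rewrite eq_le; apply/andP; split.
  apply: ge_ereal_sup => _ [V [M [_ MV]] <-]; apply/lee_addgt0Pr => e e0; rewrite add0e.
  have [t Mt fte] := H (M + 1) e e0.
  apply: (@le_trans _ _ `|f t - b|%R%:E); last by rewrite lee_fin ltW.
  apply: ereal_inf_lbound; exists t => //; apply: MV.
  by rewrite (lt_le_trans _ Mt)// ltrDl.
apply: (@le_trans _ _ (ereal_inf ((fun t => `|f t - b|%R%:E) @` setT))).
  by apply: le_ereal_inf_tmp => _ [t _ <-]; rewrite lee_fin.
by apply: ereal_sup_ubound; exists setT => //; exact: filterT.
Qed.

Definition dist_lt b (e : R) : set R := [set x | `|x - b| < e].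

Lemma open_dist_lt b e : open (dist_lt b e).
Proof.
have -> : dist_lt b e = ball b e.
  by apply/seteqP; split => x; rewrite /dist_lt /ball/= distrC.
exact: ball_open.
Qed.

Lemma measurable_dist_lt b e : measurable (dist_lt b e).
Proof. by apply: open_measurable; exact: open_dist_lt. Qed.

(** The neighbourhoods of [b] are open, so countably many radii, lower time bounds and rational
    times suffice; this makes the approach to [b] an event. *)
Lemma approaches_visits f b : cadlag f -> approaches_path f b <->
  forall k n : nat, visits (dist_lt b k.+1%:R^-1) n%:R f.
Proof.
move=> cf; split => [H k n|H N e e0].
  have [|t nt ft] := H n%:R k.+1%:R^-1; first by rewrite invr_gt0.
  have t0 : 0 <= t by rewrite (le_trans _ nt).
  have [q [tq _ fq]] := cadlag_rat cf t0 (ltr_pwDr ltr01 (lexx t)) (@open_dist_lt b _) ft.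
  by exists q; split => //; rewrite (le_trans nt)// ltW.
have [k ke] := inv_nat_lt e0.
have [q [nq fq]] := H k (Num.bound `|N|).
exists (ratr q); last exact: lt_trans ke.
by rewrite (le_trans _ nq)// (le_trans (ler_norm N))// ltW// archi_boundP.
Qed.

(** Some set of the filter has infimum above b - e. That infimum is at most [b], so a term from the
    same set lies below b + e. *)
Lemma liminf_visits (u : nat -> R) b : limn_einf (fun n => (u n)%:E) = b%:E ->
  forall e, 0 < e -> exists n, `|u n - b| < e.
Proof.
rewrite /limn_einf -/(limf_einf _ _) limf_einfE => H e e0.
have : ((b - e)%:E < ereal_sup [set ereal_inf ((fun n => (u n)%:E) @` V) | V in \oo])%E.
  by rewrite H lte_fin ltrBlDr ltrDl.
move=> /ereal_sup_gt[_ [V FV <-]] lb.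
have : (ereal_inf ((fun n => (u n)%:E) @` V) < (b + e)%:E)%E.
  apply: (@le_lt_trans _ _ b%:E); last by rewrite lte_fin ltrDl.
  by rewrite -H; apply: ereal_sup_ubound; exists V.
move=> /ereal_inf_lt[_ [n Vn <-]]; rewrite lte_fin => ub.
exists n; rewrite ltr_distl; apply/andP; split => //.
rewrite -lte_fin; apply: lt_le_trans lb _; apply: ereal_inf_lbound; by exists n.
Qed.

End Limits.

(** * Almost sure properties of an oscillating process, and local recurrence *)

Section ProcessG.
Context (d : measure_display) (Omega : measurableType d) (R : realType).
Context (P : R -> probability Omega R) (F : R -> set (set Omega)).
Context (X : R -> Omega -> R) (b : R).
Hypothesis HX : strong_markov_process P F X.
Hypothesis Hosc : oscillating P X.
Implicit Types (C D : set (R -> R)) (V : set R) (x y q N : R).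

Let on C := [set w | C (X^~ w)].
Let mon C : event setT C -> measurable (on C).
Proof. exact: (measurable_event HX). Qed.
Let cX w : cadlag (X^~ w). Proof. exact: (process_cadlag HX). Qed.

Lemma crossingE n w : crossing X b n w = up_crossing (X^~ w) b n.
Proof. by elim: n => // n IH; rewrite up_crossingS -IH. Qed.

Lemma ae_null x (A : set Omega) : measurable A -> {ae P x, forall w, ~ A w} -> P x A = 0%E.
Proof.
move=> mA [N [mN N0 sN]]; apply: (subset_measure0 mA mN _ N0).
by move=> w Aw; apply: sN => /=; exact.
Qed.

Lemma ae_one x (A : set Omega) : measurable A -> {ae P x, forall w, A w} -> P x A = 1%E.
Proof.
move=> mA aeA; have : P x (~` A) = 0%E.
  by apply: ae_null; [exact: measurableC|apply: filterS aeA => w Aw; exact].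
by rewrite probability_setC// => /eqP; rewrite sube_eq ?ltry// add0e => /eqP.
Qed.

Lemma null_setC x (A : set Omega) : measurable A -> P x A = 1%E -> P x (~` A) = 0%E.
Proof. by move=> mA A1; rewrite probability_setC// A1 subee. Qed.

Lemma ae_unbounded x : {ae P x, forall w, unbounded_both_sides (X^~ w)}.
Proof.
have [aesup aeinf] := Hosc x.
by apply: filterS2 aesup aeinf => w; exact: unbounded_of_limsup_liminf.
Qed.

Lemma ae_start x : {ae P x, forall w, X 0 w = x}.
Proof.
have m : measurable [set w | X 0 w = x] by exact: (measurable_coordinate HX (B := [set x])).
exists (~` [set w | X 0 w = x]); split => //; first exact: measurableC.
by apply: null_setC => //; exact: (process_start HX).
Qed.

Lemma markov_one x C V : measurable V -> event setT C ->
  (forall y, V y -> P y (on C) = 1%E) ->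
  {ae P x, forall w, forall q : rat, 0 <= ratr q :> R -> V (X (ratr q) w) ->
     C (shift (ratr q) (X^~ w))}.
Proof.
move=> mV eC CV.
have nCV y : V y -> P y (on [set f | ~ C f]) = 0%E.
  by move=> Vy; exact: (null_setC (mon eC) (CV y Vy)).
apply: filterS (markov_null HX x mV (event_not eC) nCV) => w H q q0 Vq.
by apply: contrapT; exact: H.
Qed.

Lemma exists_rat_gt f (c N : R) : cadlag f -> unbounded_both_sides f -> 0 <= N ->
  exists q : rat, N <= ratr q /\ c < f (ratr q).
Proof.
move=> cf /(_ c N)[[t Nt ct] _] N0.
have [||q [tq _ fq]] := @cadlag_rat _ f `]c, +oo[ t (t + 1) cf (le_trans N0 Nt) _ (@open_above _ c).
- by rewrite ltrDl.
- by rewrite /= in_itv/= ct.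
exists q; split; first by rewrite (le_trans Nt)// ltW.
by move: fq; rewrite /= in_itv/= andbT.
Qed.

Lemma visits_shift f V N (p : rat) : 0 <= ratr p :> R ->
  visits V N (shift (ratr p) f) -> visits V (ratr p + N) f.
Proof.
by move=> p0 [q [Nq Vq]]; exists (p + q); rewrite rmorphD lerD2l; split.
Qed.

Lemma visits_le f V N N' : N' <= N -> visits V N f -> visits V N' f.
Proof. by move=> NN [q [Nq Vq]]; exists q; split => //; exact: le_trans Nq. Qed.

Lemma event_approaches : event setT [set f | approaches_path f b].
Proof.
apply: (@event_ext _ _ [set f | forall k n : nat, visits (dist_lt b k.+1%:R^-1) n%:R f]).
  by move=> f cf; split => /(approaches_visits _ cf).
apply: event_forall => k; apply: event_forall => n.
by apply: event_visits => //; exact: measurable_dist_lt.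
Qed.

Lemma approachesE : approaches X b = on [set f | approaches_path f b].
Proof. by apply/seteqP; split => w /liminf_dist0. Qed.

Lemma approaches_shift f (p : rat) : 0 <= ratr p :> R ->
  approaches_path f b -> approaches_path (shift (ratr p) f) b.
Proof.
move=> p0 H N e /(H (ratr p + N))[t pt fe]; exists (t - ratr p).
  by rewrite lerBrDl.
by rewrite /shift [ratr p + _]addrC subrK.
Qed.

Lemma recurrence : (forall x, b < x ->
    {ae P x, forall w, limn_einf (fun n => (overshoot X b n w)%:E) = b%:E}) ->
  locally_recurrent P X b.
Proof.
move=> HY; rewrite /locally_recurrent approachesE.
have eV k N : 0 <= N -> event setT [set f | visits (dist_lt b k.+1%:R^-1) N f].
  by move=> N0; apply: event_visits => //; exact: measurable_dist_lt.
(* From above [b] some overshoot is within 1/(k+1) of [b], and right-continuity moves this to a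
   rational time. *)
have V1 k y : b < y -> P y (on (visits (dist_lt b k.+1%:R^-1) 0)) = 1%E.
  move=> by_; apply: ae_one; first exact/mon/eV.
  apply: filterS (HY y by_) => w /liminf_visits/(_ k.+1%:R^-1)[|n Yn]; first by rewrite invr_gt0.
  have s0 : 0 <= fine (crossing X b n w).
    by rewrite crossingE fine_ge0// up_crossing_ge0.
  have [q [sq _ fq]] := cadlag_rat (cX w) s0 (ltr_pwDr ltr01 (lexx _)) (@open_dist_lt _ b _) Yn.
  by exists q; split => //; rewrite (le_trans s0)// ltW.
(* From any start the path is almost surely above [b] at some rational time, and the previous bound
   applies after a restart there. *)
have {}V1 k y : P y (on (visits (dist_lt b k.+1%:R^-1) 0)) = 1%E.
  apply: ae_one; first exact/mon/eV.
  have H := @markov_one y _ `]b, +oo[ (measurable_itv _) (eV k 0 (lexx 0)).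
  have {}H := H (fun y by_ => V1 k y ltac:(by move: by_; rewrite /= in_itv/= andbT)).
  apply: filterS2 (ae_unbounded y) H => w uw Hw.
  have [q [q0 bq]] := exists_rat_gt b (cX w) uw (lexx 0).
  have := Hw q q0; rewrite /= in_itv/= andbT => /(_ bq)/(visits_shift q0).
  by apply: visits_le; rewrite addr0.
apply: ae_one; first exact/mon/event_approaches.
(* The visit is almost sure from every position, so no restriction is put on the position at the
   restart; restarting at the integers yields arbitrarily late visits. *)
have : {ae P b, forall w, forall k : nat, forall q : rat, 0 <= ratr q :> R ->
    setT (X (ratr q) w) ->
    visits (dist_lt b k.+1%:R^-1) 0 (shift (ratr q) (X^~ w))}.
  by apply/ae_foralln => k; apply: markov_one => //; exact: eV.
apply: filterS => w H; apply/(approaches_visits _ (cX w)) => k n.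
have := H k n%:R; rewrite ratr_nat => /(_ (ler0n _ _) I).
have := @visits_shift (X^~ w) (dist_lt b k.+1%:R^-1) 0 n%:R.
by rewrite ratr_nat addr0; apply; exact: ler0n.
Qed.

End ProcessG.

(** * Absence of touching and creeping; local transience and left limit recurrence *)

Section NoCreeping.
Context (d : measure_display) (Omega : measurableType d) (R : realType).
Context (P : R -> probability Omega R) (F : R -> set (set Omega)).
Context (X : R -> Omega -> R) (b : R).
Hypothesis HX : strong_markov_process P F X.
Hypothesis Hosc : oscillating P X.
Hypothesis Hdown : forall x, b < x ->
  (P x).-negligible (lands X (hitting X `]-oo, b]) [set b]).
Hypothesis Hup : forall x, x < b ->
  (P x).-negligible (lands X (hitting X `[b, +oo[) [set b]).
Implicit Types (C D : set (R -> R)) (V : set R) (x y q N : R).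

Let on C := [set w | C (X^~ w)].
Let mon C : event setT C -> measurable (on C).
Proof. exact: (measurable_event HX). Qed.
Let cX w : cadlag (X^~ w). Proof. exact: (process_cadlag HX). Qed.

Lemma negligible_event x C (N : set Omega) : event setT C -> (P x).-negligible N ->
  on C `<=` N -> P x (on C) = 0%E.
Proof.
move=> /mon mC [M [mM M0 NM]] CN.
by apply: (subset_measure0 mC mM _ M0); exact: subset_trans NM.
Qed.

Lemma ae_notin x (N : set Omega) : (P x).-negligible N -> {ae P x, forall w, ~ N w}.
Proof. by apply: negligibleS => w /= /contrapT. Qed.

Lemma ae_le x (A B : set Omega) : measurable A -> measurable B ->
  {ae P x, forall w, A w -> B w} -> (P x A <= P x B)%E.
Proof.
move=> mA mB AB; have mD : measurable (A `\` B) by exact: measurableD.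
have D0 : P x (A `\` B) = 0%E.
  by apply: ae_null => //; apply: filterS AB => w AB [/AB].
apply: (@le_trans _ _ (P x (B `|` (A `\` B)))).
  apply: le_measure; rewrite ?inE//; first exact: measurableU.
  by move=> w Aw; have [Bw|nBw] := pselect (B w); [left|right].
by rewrite -[leRHS]adde0 -D0; exact: measureU2.
Qed.

Lemma closed_above_setU1 : closed ([set` `]b, +oo[] `|` [set b]).
Proof.
rewrite (_ : _ `|` _ = [set x | b <= x]); first exact: closed_ge.
apply/seteqP; split => x; rewrite /= in_itv/= andbT le_eqVlt.
  by case=> [->|->]; rewrite ?eqxx ?orbT.
by move=> /orP[/eqP ->|]; [right|left].
Qed.

Lemma closed_below_setU1 : closed ([set` `]-oo, b[] `|` [set b]).
Proof.
rewrite (_ : _ `|` _ = [set x | x <= b]); first exact: closed_le.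
apply/seteqP; split => x; rewrite /= in_itv/= le_eqVlt.
  by case=> [->|->]; rewrite ?eqxx ?orbT.
by move=> /orP[/eqP ->|]; [right|left].
Qed.

(** From a start above [b], touching makes the path enter the closed lower half-line exactly at [b],
    which is null by the hypothesis on tau^b; the Markov property extends this to all rational
    restarts. *)
Lemma ae_no_touch_above x : {ae P x, forall w, forall q : rat, 0 <= ratr q :> R ->
  ~ touches (shift (ratr q) (X^~ w)) `]b, +oo[ b}.
Proof.
have eT : event setT [set f | touches f `]b, +oo[ b] by exact: event_touches.
have T0 y : [set` `]b, +oo[] y -> P y (on [set f | touches f `]b, +oo[ b]) = 0%E.
  rewrite /= in_itv/= andbT => by_; apply: (negligible_event eT (Hdown by_)) => w.
  move=> /(touches_lands (cX w) (@open_above _ b) closed_above_setU1); rewrite setCitvr.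
  by apply; rewrite /= in_itv/= ltxx.
apply: filterS (markov_null HX x (measurable_itv _) eT T0) => w H q q0 tq.
by apply: (H q q0) => //; case: tq; rewrite /shift addr0.
Qed.

Lemma ae_no_touch_below x : {ae P x, forall w, forall q : rat, 0 <= ratr q :> R ->
  ~ touches (shift (ratr q) (X^~ w)) `]-oo, b[ b}.
Proof.
have eT : event setT [set f | touches f `]-oo, b[ b] by exact: event_touches.
have T0 y : [set` `]-oo, b[] y -> P y (on [set f | touches f `]-oo, b[ b]) = 0%E.
  rewrite /= in_itv/= => yb; apply: (negligible_event eT (Hup yb)) => w.
  move=> /(touches_lands (cX w) (@open_below _ b) closed_below_setU1); rewrite setCitvl.
  by apply; rewrite /= in_itv/= ltxx.
apply: filterS (markov_null HX x (measurable_itv _) eT T0) => w H q q0 tq.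
by apply: (H q q0) => //; case: tq; rewrite /shift addr0.
Qed.

Lemma ae_no_creeping x : {ae P x, forall w, forall q : rat, 0 <= ratr q :> R ->
  ~ creeps (shift (ratr q) (X^~ w)) b}.
Proof.
(* One alternative of [creeps] contradicts the starting side; [creeps_lands] turns the other into a
   landing at [b] on first entering the closed half-line. *)
have C0 y : [set x : R | x != b] y -> P y (on [set f | creeps f b]) = 0%E.
  move=> /= yb; apply: (ae_null (mon (event_creeps b))).
  have [lt|gt|e] := ltgtP y b; last by rewrite e eqxx in yb.
  - apply: filterS2 (ae_start HX y) (ae_notin (Hup lt)) => w Xy nl [[]|[_ H]].
      by rewrite Xy ltNge (ltW lt).
    apply: nl; rewrite /lands/= -(setCitvl (BLeft b)).
    apply: (creeps_lands (B := [set` `]b, +oo[]) (cX w)) => //.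
    + by move=> z; rewrite /= !in_itv/= andbT => bz; apply/negP; rewrite -leNgt ltW.
    + move=> z; rewrite /= !in_itv/= andbT => /negP; rewrite -leNgt le_eqVlt.
      by move=> /orP[/eqP ->|]; [right|left].
    + by rewrite /= in_itv/= ltxx.
  - apply: filterS2 (ae_start HX y) (ae_notin (Hdown gt)) => w Xy nl [[_ H]|[]]; last first.
      by rewrite Xy ltNge (ltW gt).
    apply: nl; rewrite /lands/= -(setCitvr (BRight b)).
    apply: (creeps_lands (B := [set` `]-oo, b[]) (cX w)) => //.
    + by move=> z; rewrite /= !in_itv/= andbT => bz; apply/negP; rewrite -leNgt ltW.
    + move=> z; rewrite /= !in_itv/= andbT => /negP; rewrite -leNgt le_eqVlt.
      by move=> /orP[/eqP ->|]; [right|left].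
    + by rewrite /= in_itv/= ltxx.
have mV : measurable [set x : R | x != b].
  rewrite (_ : [set _ | _] = ~` [set b]); first exact: measurableC.
  by apply/seteqP; split => z /= /eqP.
(* A path restarted exactly at [b] does not creep, because [creeps] requires a start strictly on one
   side. *)
apply: filterS (markov_null HX x mV (event_creeps b) C0) => w H q q0 cq.
apply: (H q q0) => //=; apply/eqP => e; move: cq.
by rewrite /creeps /shift addr0 e ltxx => -[] [].
Qed.

Lemma transience :
  (forall x, b < x -> {ae P x, forall w, overshoot X b n w @[n --> \oo] --> +oo}) ->
  (exists r rho c : R, [/\ 0 < r, 0 < rho, c < 1 &
     (ereal_sup [set P y (lands X (crossing X b 1) `](b + rho)%R, +oo[)
                | y in [set y : R | (b - r <= y <= b + r)%R /\ y != b]]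
      < c%:E)%E]) ->
  locally_transient P X b.
Proof.
move=> HY [r [rho [c [r0 rho0 c1 Hc]]]].
pose C := [set f : R -> R | ~ path_lands f (up_crossing f b 1) `](b + rho)%R, +oo[].
have eL := event_lands_up_crossing1_above b (b + rho).
have eC : event setT C by exact: event_not.
(* The centre is removed because both the bound on overshoots and the comparison of crossings after
   a restart concern positions off [b]. *)
pose V := dist_lt b r `\` [set b].
have mV : measurable V by apply: measurableD => //; exact: measurable_dist_lt.
have CV y : V y -> ((1 - c)%:E <= P y (on C))%E.
  move=> [yr yb]; have mL := mon eL.
  have -> : P y (on C) =
      (1 - P y (on [set f | path_lands f (up_crossing f b 1) `](b + rho)%R, +oo[]))%E.
    by rewrite -probability_setC.
  rewrite EFinB leeB//; apply/ltW/(le_lt_trans _ Hc)/ereal_sup_ubound.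
  exists y; last by congr (P y _); apply/seteqP; split => w; rewrite /lands/= (crossingE _ _ 1).
  split; last exact/eqP.
  by move: yr; rewrite /dist_lt/= ltr_distl => /andP[/ltW -> /ltW ->].
have a0 : 0 < 1 - c by rewrite subr_gt0.
have W0 x : b < x -> P x (on [set f | approaches_path f b]) = 0%E.
  move=> bx.
  have := markov_visits_infinitely_often HX x mV (ltW a0) eC CV.
  (* As Y_n tends to infinity, all late restarts off [b] overshoot b + rho, so [C] fails after every
     late visit. *)
  rewrite [X in (_ <= X)%E](_ : _ = 0%E); last first.
    apply: ae_null.
      apply: mon; apply: event_forall => n; exact: event_visits_then.
    apply: filterS2 (HY x bx) (ae_unbounded Hosc x) => w Yw uw Kw.
    apply: (@diverging_overshoots_eventually_big _ (X^~ w) b (b + rho) (cX w) uw).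
      by move: Yw; rewrite /overshoot; under eq_fun do rewrite crossingE.
    by move=> n; have [q [nq [_ qb] Cq]] := Kw n; exists q.
  (* Since 1 - c > 0, arbitrarily late visits to [V] are null, whereas a path that approaches [b]
     without touching it makes such visits. *)
  move=> H0; apply: (ae_null (mon (event_approaches b))).
  have : {ae P x, forall w, ~ on [set f | forall n : nat, visits V n%:R f] w}.
    have mVV : measurable (on [set f | forall n : nat, visits V n%:R f]).
      by apply: mon; apply: event_forall => n; exact: event_visits.
    exists (on [set f | forall n : nat, visits V n%:R f]); split => //; last first.
      by move=> w /= /contrapT.
    apply/eqP; rewrite eq_le measure_ge0 andbT.
    by move: H0; rewrite pmule_rle0// lte_fin.
  apply: filterS3 (ae_unbounded Hosc x) (filterI (ae_no_touch_above x) (ae_no_touch_below x)).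
  move=> w uw [nup ndown] nV aw; apply: nV => n.
  have [q [nq qb qr]] := approach_avoiding (cX w) uw r0 nup ndown aw (ler0n _ n).
  by exists q.
(* From [b] the path almost surely gets above [b] at some rational time, and the restarted path
   inherits the approach; the probability is thus 0. *)
rewrite /locally_transient approachesE ae_null// ?lte_fin//.
  exact: mon (event_approaches b).
have W0' y : [set` `]b, +oo[] y -> P y (on [set f | approaches_path f b]) = 0%E.
  by rewrite /= in_itv/= andbT; exact: W0.
have H0 := markov_null HX b (measurable_itv _) (event_approaches b) W0'.
apply: filterS2 (ae_unbounded Hosc b) H0 => w uw H aw; have [q [q0 bq]] := exists_rat_gt b (cX w) uw (lexx 0).
by apply: (H q q0); [rewrite /= in_itv/= andbT|exact: approaches_shift].
Qed.

Lemma left_limit_recurrence :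
  (forall x, b < x -> {ae P x, forall w, overshoot X b n w @[n --> \oo] --> b}) ->
  (exists r' rho' c : R, [/\ 0 < r', 0 < rho', c < 1 &
     (ereal_sup [set P y (lands X (crossing X b 1) `]-oo, (b + rho')%R[)
                | y in [set y : R | (b + r' <= y)%R]]
      < c%:E)%E]) ->
  left_limit_recurrent P X b.
Proof.
move=> HY [r [rho [c [r0 rho0 c1 Hc]]]].
pose C := [set f : R -> R | ~ path_lands f (up_crossing f b 1) `]-oo, (b + rho)%R[].
have eL := event_lands_up_crossing1_below b (b + rho).
have eC : event setT C by exact: event_not.
have a0 : 0 < 1 - c by rewrite subr_gt0.
pose A := [set f : R -> R | clusters f b].
have eA : event setT A by exact: event_clusters.
(* The level b + r is exceeded at arbitrarily late times by oscillation, so restarts with a first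
   overshoot not below b + rho occur arbitrarily late with probability at least 1 - c; each such
   path clusters. *)
have A_ge1 x : b < x -> ((1 - c)%:E <= P x (on A))%E.
  move=> bx; pose V := [set` `](b + r), +oo[] : set R.
  have CV y : V y -> ((1 - c)%:E <= P y (on C))%E.
    rewrite /V/= in_itv/= andbT => yr; have mL := mon eL.
    have -> : P y (on C) =
      (1 - P y (on [set f | path_lands f (up_crossing f b 1) `]-oo, (b + rho)%R[]))%E.
      by rewrite -probability_setC.
    rewrite EFinB leeB//; apply/ltW/(le_lt_trans _ Hc)/ereal_sup_ubound.
    exists y; first exact: ltW.
    by congr (P y _); apply/seteqP; split => w; rewrite /lands/= (crossingE _ _ 1).
  have mV : measurable V by exact: measurable_itv.
  have := markov_visits_infinitely_often HX x mV (ltW a0) eC CV.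
  rewrite [X in (_ * X <= _)%E](_ : _ = 1%E) ?mule1; last first.
    apply: ae_one.
      by apply: mon; apply: event_forall => n; exact: event_visits.
    apply: filterS (ae_unbounded Hosc x) => w uw n.
    have [q [nq bq]] := exists_rat_gt (b + r) (cX w) uw (ler0n _ n).
    by exists q; split => //; rewrite /V/= in_itv/= andbT.
  move=> /le_trans; apply; apply: ae_le.
  - by apply: mon; apply: event_forall => n; exact: event_visits_then.
  - exact: mon.
  apply: filterS3 (HY x bx) (filterI (ae_unbounded Hosc x) (ae_start HX x)) (ae_no_creeping x).
  move=> w Yw [uw Xw] nc Kw.
  have [||||M M0 acc] := @converging_overshoots_cluster _ (X^~ w) b (b + rho) (cX w) uw _ _ nc.
  - by rewrite Xw.
  - by rewrite ltrDl.
  - by move: Yw; rewrite /overshoot; under eq_fun do rewrite crossingE.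
  - move=> N; have [q [Nq Vq Cq]] := Kw N; exists q; split => //.
    by move=> e; move: Vq; rewrite e /V/= in_itv/= andbT gtrDl ltNge (ltW r0).
  exact: clusters_by_clusters acc.
(* For an arbitrary start, restart at a rational time spent above [b]; clustering of the restarted
   path is clustering of the path. *)
have {}A_ge1 x : ((1 - c)%:E <= P x (on A))%E.
  have AV y : [set` `]b, +oo[] y -> ((1 - c)%:E <= P y (on A))%E.
    by rewrite /= in_itv/= andbT; exact: A_ge1.
  have := markov_visits HX x (measurable_itv _) (ltW a0) (lexx 0) eA AV.
  rewrite [X in (_ * X <= _)%E](_ : _ = 1%E) ?mule1; last first.
    apply: ae_one; first by apply: mon; exact: event_visits.
    apply: filterS (ae_unbounded Hosc x) => w uw.
    have [q [q0 bq]] := exists_rat_gt b (cX w) uw (lexx 0).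
    by exists q; split => //; rewrite /= in_itv/= andbT.
  move=> /le_trans; apply; apply: le_measure; rewrite ?inE.
  - by apply: mon; exact: event_visits_then.
  - exact: mon.
  - by move=> w [q [q0 _]]; exact: clusters_shift.
have A1 x : P x (on A) = 1%E.
  (* Clustering completed by time [n]: known at time [n] and increasing to the whole clustering
     event. *)
  pose G n := on [set f : R -> R | clusters_before f b n%:R].
  have [_ Fm _] := process_filtration HX.
  have FG n : F n%:R (G n) by apply: (event_adapted HX) => //; exact: event_clusters_before.
  have mG n : measurable (G n) by apply: (Fm n%:R) => //; exact: FG.
  have UG : \bigcup_n G n = on A.
    by apply/seteqP; split => [w [n _ Gn]|w [n Gn]]; exists n.
  have cv : P x \o G @ \oo --> P x (on A).
    rewrite -UG; apply: nondecreasing_cvg_mu => //; first exact: bigcup_measurable.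
    move=> m n mn; rewrite subsetEset => w [q [M [q0 M0 qM acc]]].
    by exists q, M; split => //; apply: le_trans qM _; rewrite ler_nat.
  have fP B : measurable B -> P x B = (fine (P x B))%:E.
    by move=> mB; rewrite fineK// fin_num_measure.
  set p := fine (P x (on A)).
  have pE : P x (on A) = p%:E by apply: fP; exact: mon.
  (* Restarting at [n] off [G n] gives P(G n) + (1 - c)(1 - P(G n)) <= p; then 1 - P(G n) is bounded
     below by 1 - p, which does not depend on [n]. *)
  have Gp n : (P x (G n) <= (p - (1 - c) * (1 - p))%:E)%E.
    have FC : F n%:R (~` G n).
      have [sF _ _] := process_filtration HX.
      by have [_ sC _] := sF n%:R (ler0n _ n); rewrite -setTD; exact: sC.
    have mAn : measurable [set w | A (shift n%:R (X^~ w))] by exact: (measurable_event_shift HX).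
    have Gle : (P x (G n) + (1 - c)%:E * P x (~` G n) <= P x (on A))%E.
      apply: (@le_trans _ _ (P x (G n) + P x (~` G n `&` [set w | A (shift n%:R (X^~ w))]))%E).
        apply: leeD2l; apply: (@markov_ge _ _ _ _ _ _ HX x n%:R _ _ setT) => //.
        exact: ltW.
      rewrite -measureU//; [|by apply: measurableI => //; exact: measurableC|].
        apply: le_measure; rewrite ?inE.
        - by apply: measurableU => //; apply: measurableI => //; exact: measurableC.
        - exact: mon.
        - move=> w [Gw|[_]]; first by exists n.
          by rewrite /= -(ratr_nat R n); apply: clusters_shift; rewrite ratr_nat.
      by apply/seteqP; split => // w [Gw []].
    have Gp : (P x (G n) <= P x (on A))%E.
      by apply: le_measure; rewrite ?inE//; [exact: mon|move=> w Gw; exists n].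
    move: Gle Gp; rewrite probability_setC// pE (fP _ (mG n)) -EFinB -EFinM -EFinD !lee_fin.
    set g := fine _ => Gle gp.
    have : (1 - c) * (1 - p) <= (1 - c) * (1 - g) by rewrite ler_pM2l// lerD2l lerN2.
    by move: Gle; lra.
  (* In the limit p <= p - (1 - c)(1 - p), which forces p = 1 as 1 - c > 0. *)
  have : (P x (on A) <= (p - (1 - c) * (1 - p))%:E)%E.
    rewrite -(cvg_lim _ cv)//; apply: lime_le; first by apply/cvg_ex; eexists; exact: cv.
    exact: nearW.
  rewrite pE lee_fin lerBrDr gerDl pmulr_rle0// subr_le0 => p1.
  congr (_%:E); apply/eqP; rewrite eq_le p1 andbT -lee_fin -pE.
  by apply: probability_le1; exact: mon.
(* Clustering is almost sure after every rational restart; restarting at an integer beyond [T]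
   produces a left limit [b] later than [T]. *)
have := markov_one HX b measurableT eA (fun y _ => A1 y).
apply: filterS => w H T T0.
have n0 : 0 <= ratr (Num.bound T)%:R :> R by rewrite ratr_nat.
have [s s0] := left_limit_of_clusters (cadlag_shift n0 (cX w)) (H _ n0 I).
move=> /(cvg_shift) Hs; exists (ratr (Num.bound T)%:R + s); split => //.
by rewrite ltr_wpDr// ?(ltW s0)// ratr_nat archi_boundP// ltW.
Qed.

End NoCreeping.

Theorem theorem3p3 (d : measure_display) (Omega : measurableType d)
    (R : realType) (P : R -> probability Omega R) (F : R -> set (set Omega))
    (X : R -> Omega -> R) (b : R)
    (HX : strong_markov_process P F X)
    (Hosc : oscillating P X)
    (Hdown : forall x, b < x ->
       (P x).-negligible (lands X (hitting X `]-oo, b]) [set b]))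
    (Hup : forall x, x < b ->
       (P x).-negligible (lands X (hitting X `[b, +oo[) [set b])) :
  [/\ (forall x, b < x ->
         {ae P x, forall w, overshoot X b n w @[n --> \oo] --> +oo}) ->
      (exists r rho c : R, [/\ 0 < r, 0 < rho, c < 1 &
         (ereal_sup [set P y (lands X (crossing X b 1) `](b + rho)%R, +oo[)
                    | y in [set y : R | (b - r <= y <= b + r)%R /\ y != b]]
          < c%:E)%E]) ->
      locally_transient P X b,
      (forall x, b < x ->
         {ae P x, forall w, limn_einf (fun n => (overshoot X b n w)%:E) = b%:E}) ->
      locally_recurrent P X b
    & (forall x, b < x ->
         {ae P x, forall w, overshoot X b n w @[n --> \oo] --> b}) ->
      (exists r' rho' c : R, [/\ 0 < r', 0 < rho', c < 1 &
         (ereal_sup [set P y (lands X (crossing X b 1) `]-oo, (b + rho')%R[)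
                    | y in [set y : R | (b + r' <= y)%R]]
          < c%:E)%E]) ->
      left_limit_recurrent P X b].
Proof.
split.
- exact: (transience HX Hosc Hdown Hup).
- exact: (recurrence HX Hosc).
- exact: (left_limit_recurrence HX Hosc Hdown Hup).
Qed.
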